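(* Let $\kappa$ be a nonzero integer, put $\varkappa=|\kappa|$, and let $m>0$ be an integer. Fix $m\times m$ complex matrices $\mathcal A_1$ and $\mathcal S_1>0$, a lower triangular $\varkappa\times\varkappa$ matrix $\mathcal A_2$, and an $(m+\varkappa)\times 2$ matrix $\Pi(0)=\begin{bmatrix}\Psi_1(0)\\ \Psi_2(0)\end{bmatrix}$, where $\Psi_1(0)$ is $m\times 2$ and $\Psi_2(0)$ is $\varkappa\times 2$. Assume $$\mathcal A_1\mathcal S_1-\mathcal S_1\mathcal A_1^*=\Psi_1(0)\breve J\Psi_1(0)^*,\qquad \Psi_2(0)\breve J\Psi_2(0)^*=0.$$ Let $h(0)$ be the first row of $\Psi_2(0)$. Assume that, for some $c\neq 0$, $h(0)=c[0\;\;1]$ if $\kappa$ is positive and odd or negative and even, and $h(0)=c[1\;\;0]$ if $\kappa$ is positive and even or negative and odd. Put $$A=\begin{bmatrix}\mathcal A_1&0\\ R&\mathcal A_2\end{bmatrix},\quad R=\Psi_2(0)\breve J\Psi_1(0)^*\mathcal S_1^{-1},\qquad [\theta_1\;\;\theta_2]=\Pi(0)\breve K\quad(\theta_1,\theta_2\in\mathbb C^{m+\varkappa}),$$ $$\Pi(x)=[e^{ixA}\theta_1\;\;\;e^{-ixA}\theta_2]\breve K^*,$$ $$S(x)=\begin{bmatrix}\mathcal S_1&0\\0&0\end{bmatrix}+\int_0^x\Big(e^{itA}\theta_1\theta_1^*e^{-itA^*}+e^{-itA}\theta_2\theta_2^*e^{itA^*}\Big)dt .$$ If $S(x)>0$ for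 all $x>0$, then the potential $$\widetilde q_0(x)=\breve JX(x)\breve J^*-X(x),\qquad X=\{X_{ij}\}_{i,j=1}^2:=\Pi^*S^{-1}\Pi,$$ admits the representation $$\widetilde q_0(x)=\frac{\kappa}{x}\sigma_3+\Upsilon(x)=\frac{\kappa}{x}\sigma_3+\widetilde v_a(x)\sigma_3-\widetilde v_s(x)\sigma_1,$$ where $\Upsilon$, $\widetilde v_a$ and $\widetilde v_s$ are bounded in a neighbourhood of zero and $$\widetilde v_a=X_{22}-X_{11}-\frac{\kappa}{x},\qquad \widetilde v_s=X_{12}+X_{21}.$$ Moreover, a fundamental solution $\widetilde u(x,\lambda)$ of the system $$\Big(\frac{d}{dx}-\lambda\breve J+\widetilde q_0(x)\Big)\widetilde u(x,\lambda)=0\qquad(x>0)$$ is given by $$\widetilde u(x,\lambda)=w_A(x,\lambda)\,\breve K\exp(-i\lambda x\sigma_3),\qquad w_A(x,\lambda)=I_2-\breve J\,\Pi(x)^*S(x)^{-1}(A-\lambda I_{m+\varkappa})^{-1}\Pi(x),$$ for $\lambda\notin\sigma(A)\cup\sigma(A^* )$.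
   Context: Notation: $\sigma_1=\begin{bmatrix}0&1\\1&0\end{bmatrix}$, $\sigma_3=\begin{bmatrix}1&0\\0&-1\end{bmatrix}$, $\breve J=\begin{bmatrix}0&1\\-1&0\end{bmatrix}$, $\breve K=\frac1{\sqrt2}\begin{bmatrix}1&1\\-i&i\end{bmatrix}$. $M^*$ is the conjugate transpose, $M>0$ means Hermitian positive definite, and $\sigma(A)$ is the spectrum of $A$. A neighbourhood of zero means an interval $(0,\varepsilon)$ with $\varepsilon>0$. A fundamental solution is a $2\times2$ matrix solution which is non-degenerate (invertible) for $x>0$; no normalization at $x=0$ is required. *)

(* Defs.v *)
From mathcomp Require Import all_boot all_order all_algebra.
From mathcomp Require Import sesquilinear spectral.
From mathcomp Require Import complex.
From mathcomp Require Import all_classical all_reals all_analysis.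

Set Implicit Arguments.
Unset Strict Implicit.
Unset Printing Implicit Defensive.

Import Order.TTheory GRing.Theory Num.Theory.
Import numFieldNormedType.Exports.

Local Open Scope classical_set_scope.
Local Open Scope ring_scope.
Local Open Scope complex_scope.
Local Open Scope sesquilinear_scope.

(* Complex matrices have entries in [R[i]], with [R : realType].  Limits,
   derivatives and integrals with respect to a real variable are taken entrywise
   on real and imaginary parts, where the theory over [R] applies. *)

Definition posdefmx (R : realType) (n : nat) (M : 'M[R[i]]_n) : Prop :=
  M \is hermsymmx /\
  forall v : 'cV[R[i]]_n, v != 0 -> 0 < (v ^t* *m M *m v) 0 0.

Definition expmx_partial (R : realType) (n : nat) (M : 'M[R[i]]_n) (N : nat) :
    'M[R[i]]_n :=
  \sum_(k < N) (k`!%:R)^-1 *: (M ^+ k).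

Definition expmx (R : realType) (n : nat) (M : 'M[R[i]]_n) : 'M[R[i]]_n :=
  \matrix_(i, j)
    (limn (fun N => complex.Re (expmx_partial M N i j))
     +i* limn (fun N => complex.Im (expmx_partial M N i j))).

(* Only meant for [0 <= x]: the interval is empty when [x < 0]. *)
Definition intmx (R : realType) (p q : nat) (F : R -> 'M[R[i]]_(p, q)) (x : R) :
    'M[R[i]]_(p, q) :=
  \matrix_(i, j)
    ((\int[lebesgue_measure]_(t in `[0, x]) complex.Re (F t i j))
     +i* (\int[lebesgue_measure]_(t in `[0, x]) complex.Im (F t i j))).

Definition is_derive_mx (R : realType) (p q : nat) (F : R -> 'M[R[i]]_(p, q))
    (x : R) (D : 'M[R[i]]_(p, q)) : Prop :=
  forall i j,
    is_derive x 1 (fun t => complex.Re (F t i j)) (complex.Re (D i j)) /\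
    is_derive x 1 (fun t => complex.Im (F t i j)) (complex.Im (D i j)).

Definition bounded_near_zero (R : realType) (V : normedZmodType R[i])
    (f : R -> V) : Prop :=
  exists eps M : R,
    0 < eps /\ forall x : R, 0 < x -> x < eps -> `|f x| <= M%:C.

Definition mx22 (T : Type) (a b c d : T) : 'M[T]_2 :=
  \matrix_(i, j) if i == 0 then (if j == 0 then a else b)
                 else (if j == 0 then c else d).

Definition sigma1 (R : realType) : 'M[R[i]]_2 := mx22 0 1 1 0.
Definition sigma3 (R : realType) : 'M[R[i]]_2 := mx22 1 0 0 (-1).
Definition Jb (R : realType) : 'M[R[i]]_2 := mx22 0 1 (-1) 0.
Definition Kb (R : realType) : 'M[R[i]]_2 :=
  ((Num.sqrt 2)^-1)%:C *: mx22 1 1 (- 'i) 'i.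

Arguments sigma1 {R}.
Arguments sigma3 {R}.
Arguments Jb {R}.
Arguments Kb {R}.

Definition ord_first (k : int) (hk : k != 0) : 'I_`|k|%N :=
  Ordinal (etrans (absz_gt0 k) hk).

Definition Amx (R : realType) (m k : nat) (A1 S1 : 'M[R[i]]_m)
    (A2 : 'M[R[i]]_k) (Psi1 : 'M[R[i]]_(m, 2)) (Psi2 : 'M[R[i]]_(k, 2)) :
    'M[R[i]]_(m + k) :=
  block_mx A1 0 (Psi2 *m Jb *m Psi1 ^t* *m invmx S1) A2.

Section Dressing.

Variables (R : realType) (n : nat).
Variables (A : 'M[R[i]]_n) (Pi0 : 'M[R[i]]_(n, 2)) (S0 : 'M[R[i]]_n).

Definition theta1 : 'cV[R[i]]_n := col 0 (Pi0 *m Kb).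
Definition theta2 : 'cV[R[i]]_n := col 1 (Pi0 *m Kb).

Definition Pimx (x : R) : 'M[R[i]]_(n, 2) :=
  (row_mx (expmx (('i * x%:C) *: A) *m theta1)
          (expmx ((- 'i * x%:C) *: A) *m theta2) : 'M[R[i]]_(n, 1 + 1))
  *m Kb ^t*.

Definition Smx (x : R) : 'M[R[i]]_n :=
  S0 + intmx (fun t : R =>
      expmx (('i * t%:C) *: A) *m theta1 *m theta1 ^t*
        *m expmx ((- 'i * t%:C) *: A ^t*)
      + expmx ((- 'i * t%:C) *: A) *m theta2 *m theta2 ^t*
        *m expmx (('i * t%:C) *: A ^t*)) x.

Definition Xmx (x : R) : 'M[R[i]]_2 :=
  (Pimx x) ^t* *m invmx (Smx x) *m Pimx x.

Definition potential (x : R) : 'M[R[i]]_2 :=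
  Jb *m Xmx x *m Jb ^t* - Xmx x.

Definition transfer (x : R) (lam : R[i]) : 'M[R[i]]_2 :=
  1%:M - Jb *m (Pimx x) ^t* *m invmx (Smx x) *m invmx (A - lam%:M) *m Pimx x.

End Dressing.

Definition fundamental_solution (R : realType) (q : R -> 'M[R[i]]_2)
    (lam : R[i]) (u : R -> 'M[R[i]]_2) : Prop :=
  forall x : R, 0 < x ->
    u x \in unitmx /\
    exists2 D : 'M[R[i]]_2, is_derive_mx u x D &
      D - lam *: (Jb *m u x) + q x *m u x = 0.

(* Main.v *)
(* The matrices Pi, S satisfy Pi' = - A Pi J, S' = Pi Pi^* and
   A S - S A^* = Pi J Pi^*, which yields the differential equation of the
   transfer matrix by pure algebra.

   For the singularity at zero, the rows of Pi are eliminated by successive Schur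
   complements.  If C = S21 S11^-1, the pair P = Pi2 - C Pi1, T = S22 - C S12
   satisfies again P' = - A2 P J + P q, T' = P P^*, A2 T - T A2^* = P J P^*, where
   q is the potential produced by the upper block, and
   Pi^* S^-1 Pi = Pi1^* S11^-1 Pi1 + P^* T^-1 P.  The invertible m x m block only
   contributes a regular potential.  After that, A2 being triangular, one row p is
   removed at a time: if q = (k/x) sigma3 + O(1) with |k| = n, the equation of p
   and the facts t' = |p|^2, t > 0, t -> 0 force p to be concentrated on the
   component behaving like x^n, so that p^* p / t = (2n+1)/x + O(1) on that
   component and O(1) elsewhere.  Thus each step changes k into - k - sgn k, the
   sign at the first step (n = 0) being decided by p(0) = h(0).

   The asymptotics are obtained without expansions: with F = |p|^2, the derivative
   of x F - (2n+1) t is O(x F) = O(x t'), hence x F - (2n+1) t = O(x t). *)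

(* The obstacle is that positivity of $S(x)$ is the only control on the eliminated rows near zero. A
   row whose equation has a pole of size $n/x$ would in general carry a component of size $x^{-n}$.
   For $n\ge1$ the product $xt'=x|p|^2$ would then stay bounded below, so the integral of $t'$ would
   diverge at zero. This is excluded because $S(0)$ vanishes outside its $m\times m$ corner, so that
   $t\to0$. For $n=0$ there is no pole and the argument says nothing, which is why the direction of
   $h(0)$ is prescribed. The constant $2n+1$ comes from the model $|p|^2=x^{2n}$,
   $t=x^{2n+1}/(2n+1)$. The choice of $R$ and the condition $\Psi_2(0)\breve J\Psi_2(0)^*=0$ make
   $AS-SA^*=\Pi\breve J\Pi^*$ true at $x=0$, from where the differential equations carry it to all
   $x\ge0$. *)
Require Import Defs.
From mathcomp Require Import all_boot all_order all_algebra.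
From mathcomp Require Import perm sesquilinear spectral.
From mathcomp Require Import complex.
From mathcomp Require Import all_classical all_reals all_analysis.
From mathcomp Require Import ring lra.

Import Order.TTheory GRing.Theory Num.Theory.
Import numFieldNormedType.Exports.
Local Open Scope classical_set_scope.
Local Open Scope ring_scope.
Local Open Scope complex_scope.
Local Open Scope sesquilinear_scope.

Set Implicit Arguments.
Unset Strict Implicit.
Unset Printing Implicit Defensive.

(** * Adjoint matrices and entrywise calculus *)

Section Adjoint.
Variable C : numClosedFieldType.
Implicit Types m n p q : nat.

Lemma adjmxE m n (A : 'M[C]_(m, n)) i j : (A ^t*) i j = Num.conj (A j i).
Proof. by rewrite !mxE. Qed.

Lemma adjmxN m n (A : 'M[C]_(m, n)) : (- A) ^t* = - A ^t*.
Proof. by rewrite linearN /= map_mxN. Qed.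

Lemma adjmxZ m n a (A : 'M[C]_(m, n)) : (a *: A) ^t* = Num.conj a *: A ^t*.
Proof. by rewrite linearZ /= map_mxZ. Qed.

Lemma adjmxM m n p (A : 'M[C]_(m, n)) (B : 'M[C]_(n, p)) :
  (A *m B) ^t* = B ^t* *m A ^t*.
Proof. by rewrite trmx_mul map_mxM. Qed.

Lemma adjmx1 n : (1%:M : 'M[C]_n) ^t* = 1%:M.
Proof. by rewrite trmx1 map_mx1. Qed.

Lemma adjmx0 m n : (0 : 'M[C]_(m, n)) ^t* = 0.
Proof. by rewrite trmx0 map_mx0. Qed.

Lemma adjmx_inv n (A : 'M[C]_n) : (invmx A) ^t* = invmx (A ^t*).
Proof. by rewrite trmx_inv map_invmx. Qed.

Lemma adjmx_exp n (A : 'M[C]_n) k : (A ^+ k) ^t* = (A ^t*) ^+ k.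
Proof.
elim: k => [|k IHk]; first by rewrite !expr0 -[1]/(1%:M) adjmx1.
by rewrite exprS exprSr -!mulmxE adjmxM IHk.
Qed.

Lemma hermsymmxP n (A : 'M[C]_n) : reflect (A ^t* = A) (A \is hermsymmx).
Proof.
by rewrite is_hermitianmxE expr0 scale1r eq_sym; apply: eqP.
Qed.

Lemma adjmx_block m1 m2 n1 n2 (A : 'M[C]_(m1, n1)) (B : 'M[C]_(m1, n2))
    (D : 'M[C]_(m2, n1)) (E : 'M[C]_(m2, n2)) :
  (block_mx A B D E) ^t* = block_mx (A^t*) (D^t*) (B^t*) (E^t*).
Proof. by rewrite tr_block_mx map_block_mx. Qed.

Lemma adjmx_col m1 m2 n (A : 'M[C]_(m1, n)) (B : 'M[C]_(m2, n)) :
  (col_mx A B) ^t* = row_mx (A^t*) (B^t*).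
Proof. by rewrite tr_col_mx map_row_mx. Qed.

Lemma adjmx_row m n1 n2 (A : 'M[C]_(m, n1)) (B : 'M[C]_(m, n2)) :
  (row_mx A B) ^t* = col_mx (A^t*) (B^t*).
Proof. by rewrite tr_row_mx map_col_mx. Qed.

End Adjoint.

(** * Complex-valued functions of a real variable *)

Section ComplexDerivative.
Variable R : realType.
Implicit Types (f g : R -> R[i]) (x : R) (d e z : R[i]).

Lemma conjCE z : Num.conj z = (complex.Re z) -i* (complex.Im z).
Proof. by case: z. Qed.

Definition is_cderive f x d : Prop :=
  is_derive x 1 (fun t => complex.Re (f t)) (complex.Re d) /\
  is_derive x 1 (fun t => complex.Im (f t)) (complex.Im d).

Lemma is_derive_ext (h k : R -> R) x (a b : R) :
  h =1 k -> a = b -> is_derive x 1 h a -> is_derive x 1 k b.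
Proof. by move=> /funext -> ->. Qed.

Lemma is_cderive_cst z x : is_cderive (fun=> z) x 0.
Proof. by split=> /=; apply: is_derive_cst. Qed.

Lemma is_cderiveD f g x d e :
  is_cderive f x d -> is_cderive g x e -> is_cderive (fun t => f t + g t) x (d + e).
Proof.
move=> [f1 f2] [g1 g2]; split.
  by apply: (is_derive_ext _ _ (is_deriveD f1 g1)) => [t|]; rewrite ?raddfD.
by apply: (is_derive_ext _ _ (is_deriveD f2 g2)) => [t|]; rewrite ?raddfD.
Qed.

Lemma is_cderiveN f x d : is_cderive f x d -> is_cderive (fun t => - f t) x (- d).
Proof.
move=> [f1 f2]; split.
  by apply: (is_derive_ext _ _ (is_deriveN f1)) => [t|]; rewrite ?raddfN.
by apply: (is_derive_ext _ _ (is_deriveN f2)) => [t|]; rewrite ?raddfN.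
Qed.

Lemma is_cderiveM f g x d e : is_cderive f x d -> is_cderive g x e ->
  is_cderive (fun t => f t * g t) x (d * g x + f x * e).
Proof.
move=> [f1 f2] [g1 g2]; split.
  apply: (is_derive_ext _ _ (is_deriveB (is_deriveM f1 g1) (is_deriveM f2 g2))).
    by move=> t; rewrite !fctE; case: (f t) (g t) => [a b] [a' b'].
  by move: (f x) (g x) d e {f1 f2 g1 g2} => [? ?] [? ?] [? ?] [? ?] /=;
  rewrite /GRing.scale /=; ring.
apply: (is_derive_ext _ _ (is_deriveD (is_deriveM f1 g2) (is_deriveM f2 g1))).
  by move=> t; rewrite !fctE; case: (f t) (g t) => [a b] [a' b'] /=; ring.
by move: (f x) (g x) d e {f1 f2 g1 g2} => [? ?] [? ?] [? ?] [? ?] /=;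
  rewrite /GRing.scale /=; ring.
Qed.

Lemma is_cderive_conj f x d : is_cderive f x d ->
  is_cderive (fun t => Num.conj (f t)) x (Num.conj d).
Proof.
move=> [f1 f2]; split; rewrite conjCE //=.
  by apply: (is_derive_ext _ _ f1) => [t|//]; rewrite conjCE.
by apply: (is_derive_ext _ _ (is_deriveN f2)) => [t|//]; rewrite conjCE.
Qed.

Lemma is_cderive_ext f g x d : f =1 g -> is_cderive f x d -> is_cderive g x d.
Proof. by move=> /funext ->. Qed.

Lemma near_is_cderive f g x d : (\near x, f x = g x) ->
  is_cderive f x d -> is_cderive g x d.
Proof.
by move=> fg [f1 f2]; split; [apply: near_eq_is_derive f1|apply: near_eq_is_derive f2];
  apply: filterS fg => t ->.
Qed.

Lemma is_cderive_unique f x d e : is_cderive f x d -> is_cderive f x e -> d = e.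
Proof.
move=> [f1 f2] [g1 g2]; apply/eqP; rewrite eq_complex.
by rewrite -(@derive_val _ _ _ _ _ _ _ f1) -(@derive_val _ _ _ _ _ _ _ f2)
  (@derive_val _ _ _ _ _ _ _ g1) (@derive_val _ _ _ _ _ _ _ g2) !eqxx.
Qed.

Lemma is_cderive_real (h : R -> R) x a :
  is_derive x 1 h a -> is_cderive (fun t => (h t)%:C) x a%:C.
Proof. by move=> ha; split=> //=; apply: is_derive_cst. Qed.

Lemma is_cderive_sum (I : Type) (r : seq I) (P : pred I) (F : I -> R -> R[i])
    (D : I -> R[i]) x :
  (forall i, P i -> is_cderive (F i) x (D i)) ->
  is_cderive (fun t => \sum_(i <- r | P i) F i t) x (\sum_(i <- r | P i) D i).
Proof.
move=> FD; elim: r => [|i r IHr].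
  by apply: (@is_cderive_ext (fun=> 0)) => [t|]; rewrite big_nil //; apply: is_cderive_cst.
rewrite big_cons; have [Pi|nPi] := boolP (P i); last first.
  by apply: (is_cderive_ext _ IHr) => t; rewrite big_cons (negbTE nPi).
by apply: (is_cderive_ext _ (is_cderiveD (FD _ Pi) IHr)) => t; rewrite big_cons Pi.
Qed.

Lemma is_cderive_continuous f x d : is_cderive f x d ->
  {for x, continuous (fun t => complex.Re (f t))} /\
  {for x, continuous (fun t => complex.Im (f t))}.
Proof.
by move=> [f1 f2]; split; apply/differentiable_continuous/derivable1_diffP; apply: ex_derive.
Qed.

Lemma is_cderive_neq0 f x d : is_cderive f x d -> f x != 0 -> \near x, f x != 0.
Proof.
move=> /is_cderive_continuous [f1 f2]; rewrite eq_complex negb_and => /orP[] fx0.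
  by apply: filterS (cvgr_neq0 _ f1 fx0) => t; rewrite eq_complex negb_and => ->.
by apply: filterS (cvgr_neq0 _ f2 fx0) => t; rewrite eq_complex negb_and orbC => ->.
Qed.

(** Bare existence is what determinants and inverses are asked for: the derivative of [invmx] gets
    its value from the product rule, not from cofactors. *)
Definition cderivable f x := exists d, is_cderive f x d.

Lemma cderivableV f x : f x != 0 -> cderivable f x -> cderivable (fun t => (f t)^-1) x.
Proof.
move=> fx0 [d fd].
(* $1/f=\bar f/|f|^2$ reduces the claim to the inverse of the real function $|f|^2$. *)
pose n2 t := complex.Re (f t) ^+ 2 + complex.Im (f t) ^+ 2.
have n2x : n2 x != 0.
  apply: contra fx0; rewrite eq_complex /n2 paddr_eq0 ?sqr_ge0 // !expf_eq0 /=.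
  by [].
have [f1 f2] := fd.
have Dn : exists a, is_derive x 1 n2 a.
  eexists; apply: (is_derive_ext _ _ (is_deriveD (is_deriveM f1 f1) (is_deriveM f2 f2))).
    by move=> t; rewrite /n2 !expr2.
  by [].
case: Dn => a /(is_deriveV n2x) /is_cderive_real Dv.
eexists; apply: (is_cderive_ext _ (is_cderiveM (is_cderive_conj fd) Dv)) => t.
rewrite /n2; case: (f t) => u v; rewrite conjCE /=.
have -> : (u +i* v)^-1 = (u / (u ^+ 2 + v ^+ 2)) -i* (v / (u ^+ 2 + v ^+ 2)) by [].
by apply/eqP; rewrite eq_complex /=; apply/andP; split; apply/eqP; ring.
Qed.

Lemma cderivable_prod (I : Type) (r : seq I) (F : I -> R -> R[i]) x :
  (forall i, cderivable (F i) x) -> cderivable (fun t => \prod_(i <- r) F i t) x.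
Proof.
move=> FD; elim: r => [|i r [d IHr]].
  by exists 0; apply: (@is_cderive_ext (fun=> 1)) => [t|];
    rewrite ?big_nil //; apply: is_cderive_cst.
case: (FD i) => e De; eexists.
by apply: (is_cderive_ext _ (is_cderiveM De IHr)) => t; rewrite big_cons.
Qed.

Lemma cderivable_sum (I : finType) (F : I -> R -> R[i]) x :
  (forall i, cderivable (F i) x) -> cderivable (fun t => \sum_i F i t) x.
Proof.
move=> /choice[D FD]; eexists; exact: (is_cderive_sum _ (fun i _ => FD i)).
Qed.

End ComplexDerivative.

(** * Matrix-valued functions of a real variable *)

Section MatrixDerivative.
Variable R : realType.
Implicit Types m n p q : nat.

Lemma is_derive_mx_cst m n (A : 'M[R[i]]_(m, n)) x : is_derive_mx (fun=> A) x 0.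
Proof. by move=> i j; rewrite mxE; apply: is_cderive_cst. Qed.

Lemma is_derive_mx_ext m n (F G : R -> 'M[R[i]]_(m, n)) x D E :
  F =1 G -> D = E -> is_derive_mx F x D -> is_derive_mx G x E.
Proof. by move=> /funext -> ->. Qed.

Lemma near_is_derive_mx m n (F G : R -> 'M[R[i]]_(m, n)) x D :
  (\near x, F x = G x) -> is_derive_mx F x D -> is_derive_mx G x D.
Proof.
by move=> FG FD i j; apply: near_is_cderive (FD i j); apply: filterS FG => t ->.
Qed.

Lemma is_derive_mx_unique m n (F : R -> 'M[R[i]]_(m, n)) x D E :
  is_derive_mx F x D -> is_derive_mx F x E -> D = E.
Proof.
by move=> FD FE; apply/matrixP => i j; apply: is_cderive_unique (FD i j) (FE i j).
Qed.

Lemma is_derive_mxD m n (F G : R -> 'M[R[i]]_(m, n)) x D E :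
  is_derive_mx F x D -> is_derive_mx G x E ->
  is_derive_mx (fun t => F t + G t) x (D + E).
Proof.
move=> FD GE i j; rewrite mxE.
by apply: is_cderive_ext (is_cderiveD (FD i j) (GE i j)) => t; rewrite mxE.
Qed.

Lemma is_derive_mxN m n (F : R -> 'M[R[i]]_(m, n)) x D :
  is_derive_mx F x D -> is_derive_mx (fun t => - F t) x (- D).
Proof.
move=> FD i j; rewrite mxE.
by apply: is_cderive_ext (is_cderiveN (FD i j)) => t; rewrite mxE.
Qed.

Lemma is_derive_mxM m n p (F : R -> 'M[R[i]]_(m, n)) (G : R -> 'M[R[i]]_(n, p)) x D E :
  is_derive_mx F x D -> is_derive_mx G x E ->
  is_derive_mx (fun t => F t *m G t) x (D *m G x + F x *m E).
Proof.
move=> FD GE i j; rewrite !mxE -big_split /=.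
apply: is_cderive_ext (is_cderive_sum _ (fun k _ => is_cderiveM (FD i k) (GE k j))).
by move=> t; rewrite mxE.
Qed.

Lemma is_derive_mxMl m n p (A : 'M[R[i]]_(m, n)) (G : R -> 'M[R[i]]_(n, p)) x E :
  is_derive_mx G x E -> is_derive_mx (fun t => A *m G t) x (A *m E).
Proof.
move=> GE; apply: is_derive_mx_ext (is_derive_mxM (is_derive_mx_cst A x) GE) => //.
by rewrite mul0mx add0r.
Qed.

Lemma is_derive_mxMr m n p (F : R -> 'M[R[i]]_(m, n)) (B : 'M[R[i]]_(n, p)) x D :
  is_derive_mx F x D -> is_derive_mx (fun t => F t *m B) x (D *m B).
Proof.
move=> FD; apply: is_derive_mx_ext (is_derive_mxM FD (is_derive_mx_cst B x)) => //.
by rewrite mulmx0 addr0.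
Qed.

Lemma is_derive_mx_adj m n (F : R -> 'M[R[i]]_(m, n)) x D :
  is_derive_mx F x D -> is_derive_mx (fun t => F t ^t*) x (D ^t*).
Proof.
move=> FD i j; rewrite adjmxE.
by apply: is_cderive_ext (is_cderive_conj (FD j i)) => t; rewrite adjmxE.
Qed.

Lemma is_derive_mx_ulsub m1 m2 n1 n2 (F : R -> 'M[R[i]]_(m1 + m2, n1 + n2)) x D :
  is_derive_mx F x D -> is_derive_mx (fun t => ulsubmx (F t)) x (ulsubmx D).
Proof.
move=> FD i j; rewrite !mxE.
by apply: is_cderive_ext (FD (lshift m2 i) (lshift n2 j)) => t; rewrite !mxE.
Qed.

Lemma is_derive_mx_dlsub m1 m2 n1 n2 (F : R -> 'M[R[i]]_(m1 + m2, n1 + n2)) x D :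
  is_derive_mx F x D -> is_derive_mx (fun t => dlsubmx (F t)) x (dlsubmx D).
Proof.
move=> FD i j; rewrite !mxE.
by apply: is_cderive_ext (FD (rshift m1 i) (lshift n2 j)) => t; rewrite !mxE.
Qed.

Lemma is_derive_mx_row m n1 n2 (F : R -> 'M[R[i]]_(m, n1)) (G : R -> 'M[R[i]]_(m, n2)) x D E :
  is_derive_mx F x D -> is_derive_mx G x E ->
  is_derive_mx (fun t => row_mx (F t) (G t)) x (row_mx D E).
Proof.
move=> FD GE i j; rewrite !mxE; case: fintype.splitP => k jk.
  apply: is_cderive_ext (FD i k) => t.
  by rewrite (_ : j = lshift n2 k) ?row_mxEl //; apply: val_inj.
apply: is_cderive_ext (GE i k) => t.
by rewrite (_ : j = rshift n1 k) ?row_mxEr //; apply: val_inj.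
Qed.

Lemma cderivable_det n (F : R -> 'M[R[i]]_n) x :
  (forall i j, cderivable (fun t => F t i j) x) -> cderivable (fun t => \det (F t)) x.
Proof.
move=> FD; apply: cderivable_sum => /= s.
have [d Pd] := cderivable_prod (index_enum _) (fun i => FD i (s i)).
by eexists; apply: is_cderiveM (is_cderive_cst _ x) Pd.
Qed.

Lemma near_unitmx n (F : R -> 'M[R[i]]_n) x D :
  is_derive_mx F x D -> F x \in unitmx -> \near x, F x \in unitmx.
Proof.
rewrite unitmxE unitfE => FD Fx.
have [d Dd] : cderivable (fun t => \det (F t)) x.
  by apply: cderivable_det => i j; exists (D i j); apply: FD.
by apply: filterS (is_cderive_neq0 Dd Fx) => t; rewrite unitmxE unitfE.
Qed.

(** Cofactors show that the entries of the inverse are differentiable. The value then follows by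
    differentiating $FF^{-1}=1$, which holds near $x$ because invertibility is an open condition. *)
Lemma is_derive_mxV n (F : R -> 'M[R[i]]_n) x D :
  is_derive_mx F x D -> F x \in unitmx ->
  is_derive_mx (fun t => invmx (F t)) x (- (invmx (F x) *m D *m invmx (F x))).
Proof.
move=> FD Fx; have nearF := near_unitmx FD Fx.
have FDij i j : cderivable (fun t => F t i j) x by exists (D i j); apply: FD.
have /choice[E0 E0P] : forall ij : 'I_n * 'I_n, exists e,
    is_cderive (fun t => invmx (F t) ij.1 ij.2) x e.
  move=> [i j] /=.
  have [d Dd] : cderivable (fun t => (\det (F t))^-1) x.
    apply: cderivableV; last exact: cderivable_det.
    by move: Fx; rewrite unitmxE unitfE.
  have [e De] : cderivable (fun t => \adj (F t) i j) x.
    have [c Dc] : cderivable (fun t => \det (row' j (col' i (F t)))) x.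
      apply: cderivable_det => k l; have [e De] := FDij (lift j k) (lift i l).
      by exists e; apply: is_cderive_ext De => t; rewrite !mxE.
    eexists; apply: is_cderive_ext (is_cderiveM (is_cderive_cst _ x) Dc) => t.
    by rewrite mxE.
  eexists; apply: near_is_cderive (is_cderiveM Dd De).
  by apply: filterS nearF => t Ft; rewrite /invmx Ft !mxE.
pose E : 'M[R[i]]_n := \matrix_(i, j) E0 (i, j).
have FE : is_derive_mx (fun t => invmx (F t)) x E.
  by move=> i j; rewrite mxE; apply: E0P (i, j).
have := is_derive_mxM FD FE.
have F1 : is_derive_mx (fun t => F t *m invmx (F t)) x 0.
  apply: near_is_derive_mx (is_derive_mx_cst 1%:M x).
  by apply: filterS nearF => t Ft; rewrite mulmxV.
move=> /is_derive_mx_unique /(_ F1) /eqP; rewrite addr_eq0 => /eqP DE.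
have -> : - (invmx (F x) *m D *m invmx (F x)) = E => //.
by rewrite -mulmxA DE mulmxN opprK mulmxA mulVmx // mul1mx.
Qed.

Lemma is_derive_continuous (h : R -> R) (x a : R) : is_derive x 1 h a -> {for x, continuous h}.
Proof. by move=> [? _]; apply/differentiable_continuous/derivable1_diffP. Qed.

(** The end point $0$ is included so that identities known for the initial data pass to positive
    $x$. *)
Lemma is_cderive0_cst (f : R -> R[i]) : (forall x : R, 0 <= x -> is_cderive f x 0) ->
  forall x : R, 0 <= x -> f x = f 0.
Proof.
move=> Df x; rewrite le_eqVlt => /predU1P[<- //|x0].
apply/eqP; rewrite eq_complex -!(subr_eq0 (_ (f x))).
have aux (h : R -> R) : (forall x : R, 0 <= x -> is_derive x 1 h 0) -> h x - h 0 = 0.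
  move=> Dh; have [||c _ ->] := @MVT _ h (fun=> 0) 0 x x0; last by rewrite mul0r.
    by move=> t /[!in_itv]/= /andP[/ltW t0 _]; apply: Dh.
  apply/continuous_within_itvP => //; split=> [t /[!in_itv]/= /andP[/ltW t0 _]||].
  - exact: is_derive_continuous (Dh _ t0).
  - by apply: cvg_at_right_filter; apply: is_derive_continuous (Dh _ (lexx _)).
  - by apply: cvg_at_left_filter; apply: is_derive_continuous (Dh _ (ltW x0)).
have /= -> : _ = 0 := aux (fun t => complex.Re (f t)) (fun t t0 => (Df t t0).1).
have /= -> : _ = 0 := aux (fun t => complex.Im (f t)) (fun t t0 => (Df t t0).2).
by rewrite eqxx.
Qed.

Lemma is_derive_mx0_cst m n (F : R -> 'M[R[i]]_(m, n)) :
  (forall x : R, 0 <= x -> is_derive_mx F x 0) -> forall x : R, 0 <= x -> F x = F 0.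
Proof.
move=> DF x x0; apply/matrixP => i j.
by apply: (is_cderive0_cst (f := fun t => F t i j)) x0 => t /DF /(_ i j); rewrite mxE.
Qed.

End MatrixDerivative.

(** * Matrix exponential *)

Section MatrixExponential.
Variable R : realType.
Implicit Types (n : nat) (u v : nat -> R[i]) (z : R[i]).

Definition ccvg u z : Prop :=
  ((fun N => complex.Re (u N)) @ \oo --> complex.Re z) /\
  ((fun N => complex.Im (u N)) @ \oo --> complex.Im z).

Lemma ccvg_ext u v z : u =1 v -> ccvg u z -> ccvg v z.
Proof. by move=> /funext ->. Qed.

Lemma cvg_seq_ext (f g : nat -> R) (a b : R) :
  f =1 g -> a = b -> f @ \oo --> a -> g @ \oo --> b.
Proof. by move=> /funext -> ->. Qed.

Lemma ccvg_unique u z w : ccvg u z -> ccvg u w -> z = w.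
Proof.
move=> [u1 u2] [v1 v2]; apply/eqP; rewrite eq_complex.
by rewrite (cvg_unique _ u1 v1) // (cvg_unique _ u2 v2) // !eqxx.
Qed.

Lemma ccvgD u v z w : ccvg u z -> ccvg v w -> ccvg (fun N => u N + v N) (z + w).
Proof.
move=> [u1 u2] [v1 v2]; split.
  by apply: cvg_seq_ext (cvgD u1 v1) => [N|]; rewrite raddfD.
by apply: cvg_seq_ext (cvgD u2 v2) => [N|]; rewrite raddfD.
Qed.

Lemma ccvgMl z u w : ccvg u w -> ccvg (fun N => z * u N) (z * w).
Proof.
case: z w => [a b] [c d] [/= u1 u2]; split.
  apply: cvg_seq_ext (cvgB (cvgM (cvg_cst a) u1) (cvgM (cvg_cst b) u2)) => // N.
  by rewrite !fctE /=; case: (u N).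
apply: cvg_seq_ext (cvgD (cvgM (cvg_cst a) u2) (cvgM (cvg_cst b) u1)) => // N.
by rewrite !fctE /=; case: (u N).
Qed.

Lemma ccvg_sum (I : finType) (F : I -> nat -> R[i]) (l : I -> R[i]) :
  (forall i, ccvg (F i) (l i)) -> ccvg (fun N => \sum_i F i N) (\sum_i l i).
Proof.
move=> Fl; elim: (index_enum I) => [|i r IHr].
  by apply: (@ccvg_ext (fun=> 0)) => [N|]; rewrite big_nil //; split; apply: cvg_cst.
rewrite big_cons; apply: ccvg_ext (ccvgD (Fl i) IHr) => N.
by rewrite big_cons.
Qed.

Lemma ccvg_conj u z : ccvg u z -> ccvg (fun N => Num.conj (u N)) (Num.conj z).
Proof.
move=> [u1 u2]; split; rewrite conjCE /=.
  by apply: cvg_seq_ext u1 => [N|//]; rewrite conjCE.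
by apply: cvg_seq_ext (cvgN u2) => [N|//]; rewrite conjCE.
Qed.

Lemma normc_ge_Im z : `|complex.Im z|%:C <= `|z|.
Proof.
have := normc_ge_Re (z * 'i); rewrite ReiNIm normrN normrM.
by rewrite [`|'i|]normc_def /= expr0n expr1n add0r sqrtr1 mulr1.
Qed.

Lemma scalemx_exp n z (M : 'M[R[i]]_n) k : (z *: M) ^+ k = z ^+ k *: M ^+ k.
Proof.
elim: k => [|k IHk]; first by rewrite !expr0 scale1r.
by rewrite !exprS -!mulmxE IHk -scalemxAl -scalemxAr scalerA.
Qed.

Lemma mulmx_exp_bound n (M : 'M[R[i]]_n) : exists2 B : R, 0 <= B &
  forall k i j, `|(M ^+ k) i j| <= (B ^+ k)%:C.
Proof.
(* The sum of all moduli dominates every row sum, which makes the entrywise induction on [k]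
   close. *)
pose b : R[i] := \sum_i \sum_j `|M i j|.
have b0 : 0 <= b by apply: sumr_ge0 => i _; apply: sumr_ge0.
have bR : b = (complex.Re b)%:C by rewrite RRe_real ?ger0_real.
exists (complex.Re b); first by rewrite -(lecR 0) -bR.
elim=> [|k IHk] i j.
  by rewrite !expr0 mxE; case: eqP => _; rewrite ?normr1 ?normr0 ?lexx // lecR ler01.
rewrite exprS -mulmxE mxE; apply: le_trans (ler_norm_sum _ _ _) _.
apply: (@le_trans _ _ (\sum_l `|M i l| * (complex.Re b ^+ k)%:C)).
  by apply: ler_sum => l _; rewrite normrM ler_wpM2l.
rewrite -mulr_suml exprS rmorphM /= -bR ler_wpM2r //.
  by rewrite lecR exprn_ge0 // -(lecR 0) -bR.
by rewrite /b [leRHS](bigD1 i) //= lerDl sumr_ge0 // => ? _; apply: sumr_ge0.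
Qed.

Lemma is_cvg_pseries_exp (c : nat -> R) (B D x : R) : 0 <= B ->
  (forall k, `|c k| <= D * B ^+ k / k`!%:R) -> cvgn (pseries c x).
Proof.
move=> B0 cB; apply: normed_cvg.
have D0 : 0 <= D.
  by have := le_trans (normr_ge0 _) (cB 0%N); rewrite expr0 fact0 divr1 mulr1.
apply: (@series_le_cvg _ _ (fun k => D * exp_coeff (B * `|x|) k)).
- by move=> k /=.
- move=> k; rewrite mulr_ge0 // /exp_coeff /= mulr_ge0 ?invr_ge0 //.
  by rewrite exprn_ge0 // mulr_ge0.
- move=> k /=; rewrite normrM normrX /exp_coeff /= exprMn.
  rewrite [leRHS](_ : _ = D * B ^+ k / k`!%:R * `|x| ^+ k); last by ring.
  by rewrite ler_wpM2r ?exprn_ge0.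
rewrite (_ : (fun k => _) = D *: exp_coeff (B * `|x|)); last by [].
exact/is_cvg_seriesZ/is_cvg_series_exp_coeff.
Qed.

(** Termwise differentiation keeps the shape of the bound and only changes $D$ into $DB$. One
    convergence criterion thus covers the series and its first two derived series, as
    [pseries_snd_diffs] demands. *)
Lemma pseries_diffs_bound (c : nat -> R) (B D : R) :
  (forall k, `|c k| <= D * B ^+ k / k`!%:R) ->
  forall k, `|pseries_diffs c k| <= (D * B) * B ^+ k / k`!%:R.
Proof.
move=> cB k; rewrite /pseries_diffs normrM ger0_norm //.
apply: le_trans (ler_wpM2l _ (cB k.+1)) _ => //.
rewrite factS natrM exprS invfM.
rewrite [leLHS](_ : _ = (k.+1%:R / k.+1%:R) * (D * B * B ^+ k / k`!%:R)); last by ring.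
by rewrite divff ?mul1r // pnatr_eq0.
Qed.

Lemma is_derive_pseries (c : nat -> R) (B D x : R) : 0 <= B ->
  (forall k, `|c k| <= D * B ^+ k / k`!%:R) ->
  is_derive x 1 (fun t => limn (pseries c t)) (limn (pseries (pseries_diffs c) x)).
Proof.
move=> B0 cB; apply: (@pseries_snd_diffs _ _ (`|x| + 1)).
- exact: is_cvg_pseries_exp B0 cB.
- exact: is_cvg_pseries_exp B0 (pseries_diffs_bound cB).
- exact: is_cvg_pseries_exp B0 (pseries_diffs_bound (pseries_diffs_bound cB)).
- by rewrite [ltRHS]ger0_norm ?addr_ge0 // ltrDl.
Qed.

(** * Real and imaginary parts of the exponential at once, through a real-linear form [phi] *)

Section LinearForm.
Variables (phi : {additive R[i] -> R}).
Hypothesis phiZ : forall (a : R) z, phi (a%:C * z) = a * phi z.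
Hypothesis phi_le : forall z, `|phi z|%:C <= `|z|.
Variables (n : nat) (L : 'M[R[i]]_n) (i j : 'I_n).

Lemma phi_expmx_partial x N :
  phi (expmx_partial (x%:C *: L) N i j) = pseries (fun k => phi ((L ^+ k) i j) / k`!%:R) x N.
Proof.
rewrite /pseries /series /= big_mkord /expmx_partial summxE raddf_sum /=.
apply: eq_bigr => k _; rewrite scalemx_exp !mxE mulrA.
rewrite (_ : (k`!%:R)^-1 = ((k`!%:R)^-1 : R)%:C); last by rewrite fmorphV rmorph_nat.
by rewrite -rmorphXn -rmorphM phiZ; ring.
Qed.

Lemma phi_coeff_bound : exists2 B : R, 0 <= B &
  forall k, `|phi ((L ^+ k) i j) / k`!%:R| <= 1 * B ^+ k / k`!%:R.
Proof.
have [B B0 LB] := mulmx_exp_bound L; exists B => // k.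
rewrite mul1r normrM [`|_^-1|]ger0_norm ?invr_ge0 // ler_wpM2r ?invr_ge0 //.
by rewrite -lecR (le_trans (phi_le _)).
Qed.

Lemma phi_cvg_expmx_partial x :
  (fun N => phi (expmx_partial (x%:C *: L) N i j)) @ \oo -->
    limn (fun N => phi (expmx_partial (x%:C *: L) N i j)).
Proof.
have [B B0 LB] := phi_coeff_bound; have := is_cvg_pseries_exp (x := x) B0 LB.
by rewrite (_ : pseries _ x = (fun N => phi (expmx_partial (x%:C *: L) N i j))) //;
  apply/funext => N; rewrite phi_expmx_partial.
Qed.

(** The derived series is shifted by one index, so its partial sum of length $N$ is exactly [phi] of
    the entry of $L$ times the partial sum of length $N$ of the exponential. *)
Lemma is_derive_phi_expmx x (l : R) :
  (fun N => phi ((L *m expmx_partial (x%:C *: L) N) i j)) @ \oo --> l ->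
  is_derive x 1 (fun t => limn (fun N => phi (expmx_partial (t%:C *: L) N i j))) l.
Proof.
move=> Ll; have [B B0 LB] := phi_coeff_bound.
apply: is_derive_ext (is_derive_pseries x B0 LB) => [t|].
  by congr (limn _); apply/funext => N; rewrite phi_expmx_partial.
apply/cvg_lim => //; apply: cvg_seq_ext Ll => // N.
rewrite /pseries /series /= big_mkord /expmx_partial mulmx_sumr summxE raddf_sum /=.
apply: eq_bigr => k _; rewrite scalemx_exp -scalemxAr -scalemxAr mxE mxE mulrA.
rewrite (_ : (k`!%:R)^-1 = ((k`!%:R)^-1 : R)%:C); last by rewrite fmorphV rmorph_nat.
rewrite -rmorphXn -rmorphM phiZ mulmxE -exprS /pseries_diffs factS natrM invfM.
rewrite [RHS](_ : _ = (k.+1%:R / k.+1%:R) * ((k`!%:R)^-1 * x ^+ k * phi ((L ^+ k.+1) i j))).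
  by rewrite divff ?mul1r // pnatr_eq0.
by ring.
Qed.

End LinearForm.

Lemma expmx_partial_cvg n (M : 'M[R[i]]_n) i j :
  ccvg (fun N => expmx_partial M N i j) (expmx M i j).
Proof.
rewrite -[M]scale1r -[1]/(1%:C) mxE; split=> /=.
  apply: (phi_cvg_expmx_partial (phi := @complex.Re R)).
    by move=> a [u v] /=; ring.
  exact: normc_ge_Re.
apply: (phi_cvg_expmx_partial (phi := @complex.Im R)).
  by move=> a [u v] /=; ring.
exact: normc_ge_Im.
Qed.

Lemma is_derive_expmx n (z : R[i]) (M : 'M[R[i]]_n) x :
  is_derive_mx (fun t : R => expmx ((z * t%:C) *: M)) x
    (z *: (M *m expmx ((z * x%:C) *: M))).
Proof.
have zE t : (z * t%:C) *: M = t%:C *: (z *: M) by rewrite scalerA mulrC.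
apply: (@is_derive_mx_ext _ _ _ (fun t : R => expmx (t%:C *: (z *: M)))) => [t||].
- by rewrite zE.
- by rewrite zE.
set L := z *: M; rewrite scalemxAl -/L => i j.
have Lc : ccvg (fun N => (L *m expmx_partial (x%:C *: L) N) i j)
    ((L *m expmx (x%:C *: L)) i j).
  rewrite mxE; apply: (@ccvg_ext (fun N => \sum_k L i k * expmx_partial (x%:C *: L) N k j)).
    by move=> N; rewrite mxE.
  by apply: ccvg_sum => k; apply/ccvgMl/expmx_partial_cvg.
split.
  apply: is_derive_ext (is_derive_phi_expmx (phi := @complex.Re R) _ _ Lc.1) => //.
  - by move=> t; rewrite mxE.
  - by move=> a [u v] /=; ring.
  - exact: normc_ge_Re.
apply: is_derive_ext (is_derive_phi_expmx (phi := @complex.Im R) _ _ Lc.2) => //.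
- by move=> t; rewrite mxE.
- by move=> a [u v] /=; ring.
- exact: normc_ge_Im.
Qed.

Lemma expmx_comm n (A M : 'M[R[i]]_n) : A *m M = M *m A -> A *m expmx M = expmx M *m A.
Proof.
move=> AM; apply/matrixP => i j; rewrite !mxE.
apply: (@ccvg_unique (fun N => (A *m expmx_partial M N) i j)).
  apply: (@ccvg_ext (fun N => \sum_k A i k * expmx_partial M N k j)).
    by move=> N; rewrite mxE.
  by apply: ccvg_sum => k; apply/ccvgMl/expmx_partial_cvg.
apply: (@ccvg_ext (fun N => \sum_k A k j * expmx_partial M N i k)).
  move=> N; have -> : A *m expmx_partial M N = expmx_partial M N *m A.
    rewrite /expmx_partial mulmx_sumr mulmx_suml; apply: eq_bigr => k _.
    by rewrite -scalemxAr -scalemxAl !mulmxE (commrX _ AM).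
  by rewrite mxE; apply: eq_bigr => k _; rewrite mulrC.
under eq_bigr do rewrite mulrC.
by apply: ccvg_sum => k; apply/ccvgMl/expmx_partial_cvg.
Qed.

Lemma expmx_adj n (M : 'M[R[i]]_n) : expmx (M ^t* ) = (expmx M) ^t*.
Proof.
apply/matrixP => i j; rewrite adjmxE.
apply: ccvg_unique (ccvg_conj (expmx_partial_cvg M j i)).
apply: ccvg_ext (expmx_partial_cvg _ i j) => N.
rewrite /expmx_partial !summxE rmorph_sum /=; apply: eq_bigr => k _.
by rewrite -adjmx_exp !mxE rmorphM /= fmorphV /= rmorph_nat.
Qed.

Lemma expmx0 n : expmx (0 : 'M[R[i]]_n) = 1%:M.
Proof.
apply/matrixP => i j; apply: ccvg_unique (expmx_partial_cvg _ i j) _.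
(* The partial sum of length $0$ is empty, so the sequence is constant only from index $1$ on. *)
have aux (a : R) (f : nat -> R) : (forall N, f N.+1 = a) -> f @ \oo --> a.
  by move=> fa; rewrite -cvg_shiftS; apply: cvg_seq_ext (cvg_cst a) => // N /=; rewrite fa.
have pE N : expmx_partial (0 : 'M[R[i]]_n) N.+1 = 1%:M.
  rewrite /expmx_partial big_ord_recl big1 => [|k _]; last by rewrite exprS mul0r scaler0.
  by rewrite addr0 expr0 fact0 invr1 scale1r.
by split; apply: aux => N; rewrite pE.
Qed.

(** The product $e^{-zxM}e^{zxM}$ has derivative zero and equals $1$ at $x=0$; this takes the place
    of an addition formula. *)
Lemma expmx_unit n (z : R[i]) (M : 'M[R[i]]_n) (x : R) : 0 <= x ->
  expmx ((z * x%:C) *: M) \in unitmx.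
Proof.
move=> x0; pose E t := expmx ((- z * t%:C) *: M) *m expmx ((z * t%:C) *: M).
have E1 : E x = 1%:M.
  rewrite (@is_derive_mx0_cst _ _ _ E) // => [|t _].
    by rewrite /E !mulr0 !scale0r expmx0 mulmx1.
  have ED := is_derive_mxM (is_derive_expmx (- z) M t) (is_derive_expmx z M t).
  move: ED; set D := (X in is_derive_mx _ _ X); suff -> : D = 0 by apply.
  have : M *m expmx ((- z * t%:C) *: M) = expmx ((- z * t%:C) *: M) *m M.
    by apply: expmx_comm; rewrite -scalemxAl -scalemxAr.
  rewrite /D; move: (expmx _) (expmx _) => e1 e2 ->.
  by rewrite scaleNr mulNmx -scalemxAl -mulmxA -scalemxAr addNr.
by have [] := mulmx1_unit E1.
Qed.

End MatrixExponential.

(** * Singular linear systems on the half-line *)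

Section RealCalculus.
Variable R : realType.
Implicit Types (f g h t : R -> R) (x y : R).

Lemma continuous_primitive f : continuous f -> exists F : R -> R,
  forall x, 0 <= x -> is_derive x 1 F (f x) /\
    \int[lebesgue_measure]_(s in `[0, x]) f s = F x - F 0.
Proof.
move=> cf.
have intf (a b : R) : lebesgue_measure.-integrable `[a, b] (EFin \o f).
  apply: continuous_compact_integrable; first exact: segment_compact.
  exact: continuous_subspaceT.
(* Integrating from $-1$ makes $0$ an interior point, so the primitive has a two-sided derivative
   there as well. *)
exists (fun x => \int[lebesgue_measure]_(s in `[-1, x]) f s) => x x0; split.
  have x1 : x < x + 1 by rewrite ltrDl.
  have N1x : -1 < x by rewrite (lt_le_trans _ x0) // ltrN10.
  have [dF Fx] := continuous_FTC1_closed x1 (intf _ _) N1x (cf x).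
  by apply: DeriveDef; [exact: dF | rewrite -derive1E Fx].
have [->|xn0] := eqVneq x 0; first by rewrite subrr set_itv1 Rintegral_set1.
rewrite (@Rintegral_itvB _ f (BLeft (-1)) (BRight x) 0) ?bnd_simp //.
  rewrite Rintegral_itv_obnd_cbnd //.
  by apply: integrableS (intf 0 x) => //; exact: subset_itv_oc_cc.
Qed.

Lemma mean_value (d : R) h (h' : R -> R) :
  (forall x, 0 < x -> x < d -> is_derive x 1 h (h' x)) ->
  forall x y, 0 < x -> x <= y -> y < d ->
  exists c, [/\ x <= c, c <= y & h y - h x = h' c * (y - x)].
Proof.
move=> Dh x y x0 xy yd.
have sub s : x <= s -> s <= y -> is_derive s 1 h (h' s).
  by move=> xs sy; apply: Dh; [apply: lt_le_trans xs|apply: le_lt_trans yd].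
have [s||c cxy hyx] := @MVT_segment _ h h' x y xy.
- by rewrite in_itv => /andP[/ltW xs /ltW sy]; apply: sub.
- apply: continuous_in_subspaceT => s /[1!inE] /=; rewrite in_itv => /andP[xs sy].
  exact: is_derive_continuous (sub _ xs sy).
by exists c; split=> //; move: cxy; rewrite in_itv => /andP[].
Qed.

Lemma nonincreasing_derive (d : R) h (h' : R -> R) :
  (forall x, 0 < x -> x < d -> is_derive x 1 h (h' x)) ->
  (forall x, 0 < x -> x < d -> h' x <= 0) ->
  forall x y, 0 < x -> x <= y -> y < d -> h y <= h x.
Proof.
move=> Dh h'0 x y x0 xy yd; have [c [xc cy hyx]] := mean_value Dh x0 xy yd.
rewrite -subr_le0 hyx mulr_le0_ge0 ?subr_ge0 // h'0 //.
  exact: lt_le_trans xc.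
exact: le_lt_trans yd.
Qed.

End RealCalculus.

Section SingularSystem.
Variable R : realType.
Implicit Types (f g h t : R -> R) (x y : R).

(** An upper bound suffices for positive functions, and this form passes to Schur complements, which
    only lower diagonal entries. *)
Definition vanishes_at0 t : Prop :=
  forall e : R, 0 < e -> exists2 d : R, 0 < d & forall x, 0 < x -> x < d -> t x < e.

Lemma small_radius (d C : R) : 0 < d -> 0 <= C ->
  exists e : R, [/\ 0 < e, e <= d, e <= 1 & C * e <= 1].
Proof.
move=> d0 C0; exists (Num.min d (C + 1)^-1).
have C1 : 0 < C + 1 by rewrite ltr_wpDl.
rewrite lt_min d0 invr_gt0 C1 ge_min lexx; split=> //.
  by rewrite ge_min invf_le1 // lerDr C0 orbT.
apply: (@le_trans _ _ (C * (C + 1)^-1)).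
  by rewrite ler_wpM2l // ge_min lexx orbT.
by rewrite ler_pdivrMr // mul1r lerDl.
Qed.

(* Were x * t' bounded below, t would grow by a fixed amount on every [x / 2, x]. *)
Lemma vanishing_xderive_small t (F : R -> R) (d c : R) : 0 < d -> 0 < c ->
  (forall x, 0 < x -> x < d -> is_derive x 1 t (F x)) ->
  (forall x, 0 < x -> x < d -> 0 < t x) -> vanishes_at0 t ->
  (forall x, 0 < x -> x < d -> c <= x * F x) -> False.
Proof.
move=> d0 c0 Dt t0 tv cF.
(* The threshold $c/2$ is the growth over $[x/2,x]$: at the mean value point $y$ one has $F(y)x/2\ge
   yF(y)/2\ge c/2$. *)
have [e e0 te] := tv (c / 2) (divr_gt0 c0 (ltr0Sn R 1)).
pose x := Num.min d e / 2.
have m0 : 0 < Num.min d e by rewrite lt_min d0.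
have x0 : 0 < x by rewrite divr_gt0.
have xm : x < Num.min d e by rewrite /x; lra.
have [xd xe] : x < d /\ x < e by move: xm; rewrite lt_min => /andP[].
have x2 : x / 2 <= x by lra.
have [y [xy yx tE]] := mean_value Dt (divr_gt0 x0 (ltr0Sn R 1)) x2 xd.
have y0 : 0 < y by apply: lt_le_trans xy; rewrite divr_gt0.
have yd : y < d := le_lt_trans yx xd.
have tx2 : 0 < t (x / 2) by apply: t0; [rewrite divr_gt0|apply: le_lt_trans xd].
have := te _ x0 xe; have := cF _ y0 yd.
have Fy0 : 0 < F y by rewrite -(pmulr_rgt0 _ y0) (lt_le_trans c0) // cF.
have : y * F y <= x * F y by rewrite ler_wpM2r // ltW.
by move: tE tx2; lra.
Qed.

(** * Real estimates for $f=|p|^2$, $g=|r|^2$, $h=|p||r|$, with error terms [al] and [be] *)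

Section Estimates.
Variables (n : nat) (d0 M : R) (f g h t al be : R -> R).
Hypotheses (d0_gt0 : 0 < d0) (M_ge0 : 0 <= M).
Hypothesis Df : forall x, 0 < x -> x < d0 ->
  is_derive x 1 f (2 * n%:R / x * f x + al x).
Hypothesis Dg : forall x, 0 < x -> x < d0 ->
  is_derive x 1 g (- (2 * n%:R / x * g x) + be x).
Hypothesis Dt : forall x, 0 < x -> x < d0 -> is_derive x 1 t (f x + g x).
Hypothesis t_gt0 : forall x, 0 < x -> x < d0 -> 0 < t x.
Hypothesis t_vanishes : vanishes_at0 t.
Hypotheses (f_ge0 : forall x, 0 <= f x) (g_ge0 : forall x, 0 <= g x).
Hypotheses (h_ge0 : forall x, 0 <= h x) (h2 : forall x, h x ^+ 2 = f x * g x).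
Hypothesis al_le : forall x, 0 < x -> x < d0 -> `|al x| <= M * (f x + h x).
Hypothesis be_le : forall x, 0 < x -> x < d0 -> `|be x| <= M * (h x + g x).

Let h_le x : h x <= (f x + g x) / 2.
Proof.
rewrite -ler_sqr ?nnegrE ?divr_ge0 ?addr_ge0 // h2.
by have := sqr_ge0 (f x - g x); nra.
Qed.

(* [x g - K x^3 f] is nonincreasing, and were it positive somewhere, [x t']
   would be bounded below. *)
Lemma minor_component_small : (0 < n)%N -> exists K d : R,
  [/\ 0 < K, 0 < d, d <= d0 & forall x, 0 < x -> x < d -> g x <= K * x ^+ 2 * f x].
Proof.
move=> n_gt0; have n1 : 1 <= n%:R :> R by rewrite ler1n.
(* From $h^2=fg$ one gets $Mxh\le g/2+M^2x^2f/2$, and the term $Kx^3f$ of [psi] has to absorb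
   $M^2x^2f$. The added $1$ leaves a spare $x^2f$ for the remaining errors. *)
pose K := M ^+ 2 + 1.
have K0 : 0 < K by rewrite ltr_wpDl // sqr_ge0.
have MK0 : 0 <= M * K by rewrite mulr_ge0 // ltW.
(* The radius makes both $Mx$ and $MKx$ at most $1/8$. *)
have [d [d_gt0 dd0 d1 dC]] := small_radius d0_gt0
  (addr_ge0 (mulr_ge0 (ler0n R 8) M_ge0) (mulr_ge0 (ler0n R 8) MK0)).
exists K, d; split=> // x1 x10 x1d.
pose psi x := x * g x - K * x ^+ 3 * f x.
pose psi' x := g x + x * (- (2 * n%:R / x * g x) + be x)
  - (3 * K * x ^+ 2 * f x + K * x ^+ 3 * (2 * n%:R / x * f x + al x)).
have Dpsi x : 0 < x -> x < d -> is_derive x 1 psi (psi' x).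
  move=> x0 xd; have xd0 : x < d0 := lt_le_trans xd dd0.
  have Dx := is_derive_id x (1 : R).
  have Dx3 := is_deriveM Dx (is_deriveM Dx Dx).
  have DK := is_derive_cst K x (1 : R).
  apply: is_derive_ext (is_deriveB (is_deriveM Dx (Dg x0 xd0))
    (is_deriveM (is_deriveM DK Dx3) (Df x0 xd0))) => [s|].
    by rewrite /psi !fctE /=; ring.
  rewrite /psi' /GRing.scale /= !fctE /=; ring.
have psi'_le0 x : 0 < x -> x < d -> psi' x <= 0.
  move=> x0 xd; have xd0 : x < d0 := lt_le_trans xd dd0.
  have xn0 : x != 0 by rewrite gt_eqF.
  have -> : psi' x = (1 - 2 * n%:R) * g x + x * be x - K * (3 + 2 * n%:R) * x ^+ 2 * f x
      - K * x ^+ 3 * al x.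
    by rewrite /psi'; field.
  have Mx : 8 * M * x + 8 * (M * K) * x <= 1.
    apply: le_trans dC; rewrite -mulrDl ler_wpM2l //; last exact: ltW.
    by rewrite addr_ge0 // !mulr_ge0 // ltW.
  have := al_le x0 xd0; have := be_le x0 xd0; rewrite !ler_norml => /andP[_ bex] /andP[alx _].
  have Mh : M * x * h x <= g x / 2 + M ^+ 2 * x ^+ 2 * f x / 2.
    rewrite -ler_sqr ?nnegrE.
    - have -> : (M * x * h x) ^+ 2 = M ^+ 2 * x ^+ 2 * (f x * g x) by rewrite -h2; ring.
      rewrite -subr_ge0; have := sqr_ge0 ((g x - M ^+ 2 * x ^+ 2 * f x) / 2).
      by congr (0 <= _); field.
    - by rewrite !mulr_ge0 // ltW.
    - by rewrite addr_ge0 // divr_ge0 // !mulr_ge0 // ltW.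
  have x2 : 0 <= x ^+ 2 by rewrite sqr_ge0.
  have Kx2 : 0 <= K * x ^+ 2 * f x by rewrite !mulr_ge0 // ltW.
  (* Here $n\ge1$ enters: the pole outweighs the derivative of the factor $x$ and leaves a full
     $-g$. *)
  have e1 : (1 - 2 * n%:R) * g x <= - g x by have := g_ge0 x; nra.
  have e2 : x * be x <= g x / 2 + M ^+ 2 * x ^+ 2 * f x / 2 + M * x * g x.
    apply: le_trans (ler_wpM2l (ltW x0) bex) _.
    by move: Mh; rewrite mulrDr; lra.
  have e3 : 5 * (K * x ^+ 2 * f x) <= K * (3 + 2 * n%:R) * x ^+ 2 * f x.
    by move: Kx2; nra.
  have e4 : - (K * x ^+ 3 * al x) <= M * K * x * (x ^+ 2 * (3 * f x + g x) / 2).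
    have Kx3 : 0 <= K * x ^+ 3 by rewrite mulr_ge0 ?exprn_ge0 // ltW.
    rewrite -mulrN; apply: (@le_trans _ _ (K * x ^+ 3 * (M * (f x + (f x + g x) / 2)))).
      rewrite ler_wpM2l //; have := ler_wpM2l M_ge0 (h_le x); move: alx.
      by rewrite !mulrDr; lra.
    by rewrite le_eqVlt; apply/orP; left; apply/eqP; field.
  have Mx' : 0 <= M * x by rewrite mulr_ge0 // ltW.
  have MKx' : 0 <= M * K * x by rewrite mulr_ge0 // ltW.
  have e5 : M * x * g x <= g x / 8 by have := g_ge0 x; nra.
  have x21 : x ^+ 2 <= 1 by rewrite expr_le1 // ltW // (lt_le_trans xd).
  have e6 : M * K * x * (x ^+ 2 * (3 * f x + g x) / 2) <= x ^+ 2 * (3 * f x + g x) / 16.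
    have : 0 <= x ^+ 2 * (3 * f x + g x) by rewrite mulr_ge0 // addr_ge0 // mulr_ge0.
    by nra.
  have e7 : x ^+ 2 * g x <= g x by rewrite -[leRHS]mul1r ler_wpM2r.
  have e8 : M ^+ 2 * x ^+ 2 * f x = K * x ^+ 2 * f x - x ^+ 2 * f x by rewrite /K; ring.
  by have := g_ge0 x; have := mulr_ge0 x2 (f_ge0 x); lra.
rewrite leNgt; apply/negP => gf.
have c0 : 0 < psi x1.
  by rewrite /psi (_ : _ - _ = x1 * (g x1 - K * x1 ^+ 2 * f x1)) ?mulr_gt0 ?subr_gt0 //; ring.
apply: (@vanishing_xderive_small t (fun x => f x + g x) x1 (psi x1)) => //.
- by move=> x x0 xx1; apply: Dt => //; apply: lt_trans xx1 (lt_le_trans x1d dd0).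
- by move=> x x0 xx1; apply: t_gt0 => //; apply: lt_trans xx1 (lt_le_trans x1d dd0).
move=> x x0 xx1; apply: le_trans (nonincreasing_derive Dpsi psi'_le0 x0 (ltW xx1) x1d) _.
rewrite /psi mulrDr addrC lerD //.
  by rewrite (@le_trans _ _ 0) ?oppr_le0 ?mulr_ge0 // ?exprn_ge0 // ltW //.
Qed.

(** No limit of $x(f+g)$ at zero is known, so the bound on the derivative of $G=x(f+g)-(2n+1)t$
    cannot be integrated from $0$. Instead, $\pm G-Cxt$ is nonincreasing; were it positive at $x_1$,
    then $\pm G$ would be bounded below by a positive constant on $(0,x_1)$. With the sign $+$ this
    bounds $xt'$ below, with the sign $-$ it bounds $t$ below, and both contradict $t\to0$. *)
Lemma xderive_ratio (K : R) : 0 <= K ->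
  (forall x, 0 < x -> x < d0 -> g x <= K * x ^+ 2 * f x) ->
  exists C d : R, [/\ 0 <= C, 0 < d, d <= d0 & forall x, 0 < x -> x < d ->
    `|x * (f x + g x) - (2 * n%:R + 1) * t x| <= C * x * t x].
Proof.
(* The poles cancel in $G'$ up to $-4ng$, and $g\le Kx^2f\le Kx(f+g)$ for $x\le1$. The summand $2M$
   bounds the error terms, as $2h\le f+g$. *)
move=> K0 gK; pose C := 4 * n%:R * K + 2 * M.
have C0 : 0 <= C by rewrite addr_ge0 // !mulr_ge0.
have [d [d_gt0 dd0 d1 _]] := small_radius d0_gt0 (ler0n R 0).
exists C, d; split=> //.
pose F x := f x + g x.
pose G x := x * F x - (2 * n%:R + 1) * t x.
pose G' x := - (4 * n%:R * g x) + x * (al x + be x).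
have DG x : 0 < x -> x < d -> is_derive x 1 G (G' x).
  move=> x0 xd; have xd0 : x < d0 := lt_le_trans xd dd0.
  have DN := is_derive_cst (2 * n%:R + 1 : R) x (1 : R).
  apply: is_derive_ext (is_deriveB (is_deriveM (is_derive_id x (1 : R))
    (is_deriveD (Df x0 xd0) (Dg x0 xd0))) (is_deriveM DN (Dt x0 xd0))) => [s|].
    by rewrite /G /F !fctE.
  rewrite /G' /GRing.scale /= !fctE /=.
  by have xn0 : x != 0 by [rewrite gt_eqF]; field.
have Dxt x : 0 < x -> x < d -> is_derive x 1 (fun s => C * s * t s) (C * t x + C * x * F x).
  move=> x0 xd; have xd0 : x < d0 := lt_le_trans xd dd0.
  have DC := is_derive_cst C x (1 : R).
  apply: is_derive_ext (is_deriveM (is_deriveM DC (is_derive_id x (1 : R))) (Dt x0 xd0)) => [s|].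
    by rewrite !fctE.
  by rewrite /F /GRing.scale /= !fctE /=; ring.
have G'_le x : 0 < x -> x < d -> `|G' x| <= C * x * F x.
  move=> x0 xd; have xd0 : x < d0 := lt_le_trans xd dd0.
  have := al_le x0 xd0; have := be_le x0 xd0; rewrite !ler_norml => /andP[be1 be2] /andP[al1 al2].
  have Mx : 0 <= M * x by rewrite mulr_ge0 // ltW.
  have Mh := ler_wpM2l Mx (h_le x).
  have xF : `|x * (al x + be x)| <= 2 * M * x * F x.
    rewrite ler_norml; apply/andP; split.
      rewrite -lerN2 opprK -mulrN.
      have := ler_wpM2l (ltW x0) (_ : - (al x + be x) <= M * (f x + g x + 2 * h x)).
      by move=> /(_ _)/le_trans; apply; [lra|rewrite /F; lra].
    have := ler_wpM2l (ltW x0) (_ : al x + be x <= M * (f x + g x + 2 * h x)).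
    by move=> /(_ _)/le_trans; apply; [lra|rewrite /F; lra].
  have ng : 0 <= 4 * n%:R * g x <= 4 * n%:R * K * x * F x.
    rewrite !mulr_ge0 //= -!mulrA ler_wpM2l // ler_wpM2l //.
    apply: le_trans (gK x x0 xd0) _.
    rewrite -mulrA ler_wpM2l // expr2 -mulrA ler_wpM2l ?(ltW x0) //.
    apply: (@le_trans _ _ (1 * f x)); first by rewrite ler_wpM2r // ltW // (lt_le_trans xd).
    by rewrite mul1r /F lerDl.
  move: xF ng; rewrite /G' /C !ler_norml => /andP[? ?] /andP[? ?].
  by apply/andP; split; lra.
have sgn (s : R) : `|s| = 1 -> forall x, 0 < x -> x < d -> s * G x <= C * x * t x.
  move=> s1 x1 x10 x1d; rewrite leNgt; apply/negP => tG.
  pose psi x := s * G x - C * x * t x.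
  pose psi' x := s * G' x - (C * t x + C * x * F x).
  have Dpsi x : 0 < x -> x < d -> is_derive x 1 psi (psi' x).
    move=> x0 xd; apply: is_derive_ext (is_deriveB
      (is_deriveM (is_derive_cst s x (1 : R)) (DG x x0 xd)) (Dxt x x0 xd)) => [y|].
      by rewrite !fctE.
    by rewrite /psi' /GRing.scale /= mulr0 addr0.
  have psi'_le0 x : 0 < x -> x < d -> psi' x <= 0.
    move=> x0 xd; have xd0 : x < d0 := lt_le_trans xd dd0.
    have Ct : 0 <= C * t x by rewrite mulr_ge0 // ltW // t_gt0.
    have : s * G' x <= C * x * F x.
      by apply: le_trans (ler_norm _) _; rewrite normrM s1 mul1r G'_le.
    by rewrite /psi'; lra.
  have psi_ge x : 0 < x -> x < x1 -> psi x1 <= s * G x.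
    move=> x0 xx1; apply: le_trans (nonincreasing_derive Dpsi psi'_le0 x0 (ltW xx1) x1d) _.
    rewrite /psi gerBl !mulr_ge0 //; first exact: ltW.
    by rewrite ltW // t_gt0 // (lt_trans xx1) // (lt_le_trans x1d).
  have c0 : 0 < psi x1 by rewrite subr_gt0.
  have xd0 x : x < x1 -> x < d0 by move=> xx1; apply: lt_trans xx1 (lt_le_trans x1d dd0).
  have : s = 1 \/ s = -1.
    have /eqP := s1; rewrite eqr_norml ler01 andbT => /orP[]/eqP; tauto.
  case=> sE.
    apply: (@vanishing_xderive_small t F x1 (psi x1)) => //.
    - by move=> x x0 xx1; apply: Dt => //; apply: xd0.
    - by move=> x x0 xx1; apply: t_gt0 => //; apply: xd0.
    move=> x x0 xx1; apply: le_trans (psi_ge x x0 xx1) _; rewrite sE mul1r /G gerBl.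
    by rewrite mulr_ge0 ?addr_ge0 ?mulr_ge0 // ltW // t_gt0 // xd0.
  have N0 : 0 < 2 * n%:R + 1 :> R by rewrite ltr_wpDl // mulr_ge0.
  have [e e0 te] := t_vanishes (divr_gt0 c0 N0).
  pose x := Num.min e x1 / 2.
  have m0 : 0 < Num.min e x1 by rewrite lt_min e0.
  have x0 : 0 < x by rewrite divr_gt0.
  have : x < Num.min e x1 by rewrite /x; lra.
  rewrite lt_min => /andP[xe xx1].
  have := te x x0 xe; rewrite ltr_pdivlMr // => tx.
  have := psi_ge x x0 xx1; rewrite sE mulN1r /G opprB => psi1.
  have : 0 <= x * F x by rewrite mulr_ge0 ?addr_ge0 // ltW.
  by lra.
move=> x x0 xd; have := sgn 1 (normr1 _) x x0 xd; have := sgn (-1) (normrN1 _) x x0 xd.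
by rewrite mul1r mulN1r /G /F ler_norml => ? ?; apply/andP; split; lra.
Qed.

Lemma singular_ratios (K : R) : 0 <= K ->
  (forall x, 0 < x -> x < d0 -> g x <= K * x ^+ 2 * f x) ->
  exists C d : R, [/\ 0 <= C, 0 < d, d <= d0 & forall x, 0 < x -> x < d ->
    [/\ `|f x / t x - (2 * n%:R + 1) / x| <= C, g x / t x <= C & h x / t x <= C]].
Proof.
move=> K0 gK; have [C [d [C0 d_gt0 dd0 CF]]] := xderive_ratio K0 gK.
have [e [e0 ed e1 _]] := small_radius d_gt0 (ler0n R 0).
(* $K+1$ stands in for $\sqrt K$: $h^2\le Kx^2f^2\le((K+1)xf)^2$, while $xf/t\le C+N$. *)
pose N : R := 2 * n%:R + 1; pose D := (K + 1) * (C + N).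
have N0 : 0 <= N by rewrite addr_ge0 // mulr_ge0.
have D0 : 0 <= D by rewrite mulr_ge0 ?addr_ge0.
exists (C + D), e; split=> //; [exact: addr_ge0|exact: le_trans ed dd0|].
move=> x x0 xe; have xd := lt_le_trans xe ed; have xd0 := lt_le_trans xd dd0.
have t0 := t_gt0 x0 xd0; have x1 : x <= 1 by rewrite ltW // (lt_le_trans xe).
have tn0 : t x != 0 by rewrite gt_eqF.
have xn0 : x != 0 by rewrite gt_eqF.
have FC : `|(f x + g x) / t x - N / x| <= C.
  rewrite [X in `|X|](_ : _ = (x * (f x + g x) - N * t x) / (x * t x)); last first.
    by field; rewrite ?xn0 ?tn0.
  by rewrite normrM normfV [`|x * t x|]gtr0_norm ?mulr_gt0 //
    ler_pdivrMr ?mulr_gt0 // mulrA; exact: CF.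
have ft0 : 0 <= f x / t x by rewrite divr_ge0 // ltW.
have gt0 : 0 <= g x / t x by rewrite divr_ge0 // ltW.
have xf : x * (f x / t x) <= C + N.
  have : f x / t x <= C + N / x by move: FC; rewrite mulrDl ler_norml => /andP[_]; lra.
  move=> /(ler_wpM2l (ltW x0))/le_trans; apply.
  rewrite mulrDr (mulrC _ (N / x)) divfK // lerD2r -[leRHS]mul1r.
  by rewrite ler_wpM2r.
have hD : h x / t x <= D.
  apply: (@le_trans _ _ ((K + 1) * x * f x / t x)).
    rewrite ler_wpM2r ?invr_ge0 ?(ltW t0) // -ler_sqr ?nnegrE ?mulr_ge0 ?addr_ge0 ?(ltW x0) //.
    rewrite h2; apply: le_trans (ler_wpM2l (f_ge0 x) (gK x x0 xd0)) _.
    have y0 : 0 <= x ^+ 2 * f x ^+ 2 by rewrite mulr_ge0 ?sqr_ge0.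
    rewrite -subr_ge0 [leRHS](_ : _ = (K ^+ 2 + K + 1) * (x ^+ 2 * f x ^+ 2)); last by ring.
    by rewrite mulr_ge0 // !addr_ge0 ?sqr_ge0.
  by rewrite /D -!mulrA ler_wpM2l ?addr_ge0.
have gD : g x / t x <= D.
  apply: (@le_trans _ _ (K * x ^+ 2 * f x / t x)).
    by rewrite ler_wpM2r ?invr_ge0 ?(ltW t0) // gK.
  have xxf : x ^+ 2 * (f x / t x) <= C + N.
    apply: le_trans xf; rewrite expr2 -mulrA ler_wpM2l ?(ltW x0) //.
    by rewrite -[leRHS]mul1r ler_wpM2r.
  rewrite /D -!mulrA; apply: ler_pM => //; rewrite ?lerDl //.
  - exact: mulr_ge0 (ltW x0) (mulr_ge0 (ltW x0) ft0).
  - by rewrite mulrA -expr2.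
split; [|lra|lra].
have -> : f x / t x - N / x = ((f x + g x) / t x - N / x) - g x / t x by field; rewrite ?xn0 ?tn0.
apply: le_trans (ler_normB _ _) _; apply: lerD => //.
by rewrite ger0_norm.
Qed.

End Estimates.
End SingularSystem.

Section BoundedNearZero.
Variable R : realType.
Variable V : normedZmodType R[i].
Implicit Types f g : R -> V.

Lemma bounded_near_zeroD f g : bounded_near_zero f -> bounded_near_zero g ->
  bounded_near_zero (fun x => f x + g x).
Proof.
move=> [d [M [d0 fM]]] [e [N [e0 gN]]]; exists (Num.min d e), (M + N).
rewrite lt_min d0; split=> // x x0; rewrite lt_min => /andP[xd xe].
by apply: le_trans (ler_normD _ _) _; rewrite rmorphD lerD ?fM ?gN.
Qed.

Lemma bounded_near_zeroN f : bounded_near_zero f -> bounded_near_zero (fun x => - f x).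
Proof. by move=> [d [M [d0 fM]]]; exists d, M; split=> // x x0 xd; rewrite normrN fM. Qed.

Lemma bounded_near_zero_eq f g d : 0 < d -> (forall x, 0 < x -> x < d -> f x = g x) ->
  bounded_near_zero f -> bounded_near_zero g.
Proof.
move=> d0 fg [e [M [e0 fM]]]; exists (Num.min d e), M; rewrite lt_min d0; split=> // x x0.
by rewrite lt_min => /andP[xd xe]; rewrite -fg // fM.
Qed.

Lemma bounded_near_zero_cst (v : V) : bounded_near_zero (fun=> v).
Proof.
exists 1, (complex.Re `|v|); split=> // x _ _.
by rewrite RRe_real ?ger0_real.
Qed.

End BoundedNearZero.

(** * The complex system, reduced to squared moduli *)

Section ComplexSingularSystem.
Variable R : realType.
Implicit Types (z w : R[i]) (x : R).

Definition nrm z : R := complex.Re `|z|.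

Lemma nrmE z : (nrm z)%:C = `|z|.
Proof. by rewrite /nrm RRe_real ?ger0_real. Qed.

Lemma nrm_ge0 z : 0 <= nrm z.
Proof. by rewrite -ler0c nrmE. Qed.

Lemma nrm2 z : nrm z ^+ 2 = complex.Re (z * Num.conj z).
Proof.
by apply: complexI; rewrite rmorphXn /= nrmE normCK RRe_real // -normCK ger0_real ?exprn_ge0.
Qed.

Lemma nrm2C z : (nrm z ^+ 2)%:C = z * Num.conj z.
Proof. by rewrite rmorphXn /= nrmE normCK. Qed.

Lemma nrmM z w : nrm (z * w) = nrm z * nrm w.
Proof. by apply: complexI; rewrite rmorphM /= !nrmE normrM. Qed.

Lemma nrm_conj z : nrm (Num.conj z) = nrm z.
Proof. by apply: complexI; rewrite !nrmE norm_conjC. Qed.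

Lemma Re_le_nrm z : `|complex.Re z| <= nrm z.
Proof. by rewrite -lecR nrmE normc_ge_Re. Qed.

Lemma nrm_le z (M : R) : (nrm z <= M) = (`|z| <= M%:C).
Proof. by rewrite -nrmE lecR. Qed.

Lemma nrmD z w : nrm (z + w) <= nrm z + nrm w.
Proof. by rewrite -lecR rmorphD /= !nrmE ler_normD. Qed.

Lemma is_derive_nrm2 (p : R -> R[i]) x d : is_cderive p x d ->
  is_derive x 1 (fun s => nrm (p s) ^+ 2) (2 * complex.Re (d * Num.conj (p x))).
Proof.
move=> pd; have [D _] := is_cderiveM pd (is_cderive_conj pd).
apply: is_derive_ext D => [s|]; first by rewrite nrm2.
by case: (p x) d {pd} => a b [c e]; rewrite !conjCE /=; ring.
Qed.

Variables (n : nat) (d0 : R) (p r T e11 e12 e21 e22 : R -> R[i]).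
Hypothesis d0_gt0 : 0 < d0.
Hypothesis Dp : forall x, 0 < x -> x < d0 ->
  is_cderive p x (n%:R / x%:C * p x + e11 x * p x + e12 x * r x).
Hypothesis Dr : forall x, 0 < x -> x < d0 ->
  is_cderive r x (- (n%:R / x%:C) * r x + e21 x * p x + e22 x * r x).
Hypothesis DT : forall x, 0 < x -> x < d0 ->
  is_cderive T x (p x * Num.conj (p x) + r x * Num.conj (r x)).
Hypothesis T_gt0 : forall x, 0 < x -> x < d0 -> 0 < T x.
Hypothesis T_vanishes : vanishes_at0 (fun x => complex.Re (T x)).
Hypotheses (e11_bnd : bounded_near_zero e11) (e12_bnd : bounded_near_zero e12).
Hypotheses (e21_bnd : bounded_near_zero e21) (e22_bnd : bounded_near_zero e22).
Hypothesis minor_small : (0 < n)%N \/ exists K d : R, [/\ 0 <= K, 0 < d &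
  forall x, 0 < x -> x < d -> nrm (r x) <= K * x * nrm (p x)].

(** Differentiating $|p|^2$ and $|r|^2$ doubles the real part of the error, so the real estimates
    are applied with $2M$. For $n=0$ the vanishing of [T] cannot tell $p$ from $r$, and the
    smallness of $r$ has to be supplied. *)
Lemma singular_system_ratios :
  [/\ bounded_near_zero (fun x => Num.conj (p x) * p x / T x - (2 * n%:R + 1) / x%:C),
      bounded_near_zero (fun x => Num.conj (r x) * r x / T x),
      bounded_near_zero (fun x => Num.conj (p x) * r x / T x) &
      bounded_near_zero (fun x => Num.conj (r x) * p x / T x)].
Proof.
have [d [M [d_gt0 dd0 M0 eM]]] : exists d M : R, [/\ 0 < d, d <= d0, 0 <= M &
    forall x, 0 < x -> x < d ->
    [/\ nrm (e11 x) <= M, nrm (e12 x) <= M, nrm (e21 x) <= M & nrm (e22 x) <= M]].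
  case: e11_bnd e12_bnd e21_bnd e22_bnd =>
    [d1 [M1 [d1p e1]]] [d2 [M2 [d2p e2]]] [d3 [M3 [d3p e3]]] [d4 [M4 [d4p e4]]].
  exists (Num.min d0 (Num.min (Num.min d1 d2) (Num.min d3 d4))).
  exists (`|M1| + `|M2| + `|M3| + `|M4|).
  rewrite !lt_min d0_gt0 d1p d2p d3p d4p ge_min lexx; split=> //.
  move=> x x0; rewrite !lt_min => /andP[xd0 /andP[/andP[xd1 xd2] /andP[xd3 xd4]]].
  have := (ler_norm M1, ler_norm M2, ler_norm M3, ler_norm M4).
  have := (normr_ge0 M1, normr_ge0 M2, normr_ge0 M3, normr_ge0 M4).
  have := e1 x x0 xd1; have := e2 x x0 xd2; have := e3 x x0 xd3; have := e4 x x0 xd4.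
  by rewrite -!nrm_le => ? ? ? ? [[[? ?] ?] ?] [[[? ?] ?] ?]; split; lra.
pose f x := nrm (p x) ^+ 2; pose g x := nrm (r x) ^+ 2; pose h x := nrm (p x) * nrm (r x).
pose t x := complex.Re (T x).
pose al x := 2 * complex.Re ((e11 x * p x + e12 x * r x) * Num.conj (p x)).
pose be x := 2 * complex.Re ((e21 x * p x + e22 x * r x) * Num.conj (r x)).
have ReZ (a : R) z : complex.Re (a%:C * z) = a * complex.Re z.
  by case: z => u v /=; ring.
have ReD z w : complex.Re (z + w) = complex.Re z + complex.Re w by rewrite raddfD.
have nxE x : n%:R / x%:C = (n%:R / x)%:C :> R[i] by rewrite rmorphM fmorphV /= rmorph_nat.
have Df x : 0 < x -> x < d -> is_derive x 1 f (2 * n%:R / x * f x + al x).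
  move=> x0 xd; apply: is_derive_ext (is_derive_nrm2 (Dp x0 (lt_le_trans xd dd0))) => //.
  rewrite /al /f nrm2.
  rewrite (_ : (_ + _ + _) * _ = (n%:R / x)%:C * (p x * Num.conj (p x))
    + (e11 x * p x + e12 x * r x) * Num.conj (p x)); last by rewrite -nxE; ring.
  by rewrite ReD ReZ; ring.
have Dg x : 0 < x -> x < d -> is_derive x 1 g (- (2 * n%:R / x * g x) + be x).
  move=> x0 xd; apply: is_derive_ext (is_derive_nrm2 (Dr x0 (lt_le_trans xd dd0))) => //.
  rewrite /be /g nrm2.
  rewrite (_ : (_ + _ + _) * _ = (- (n%:R / x))%:C * (r x * Num.conj (r x))
    + (e21 x * p x + e22 x * r x) * Num.conj (r x)); last by rewrite rmorphN /= -nxE; ring.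
  by rewrite ReD ReZ; ring.
have Dt x : 0 < x -> x < d -> is_derive x 1 t (f x + g x).
  move=> x0 xd; have [D _] := DT x0 (lt_le_trans xd dd0).
  by apply: is_derive_ext D => //; rewrite raddfD /= /f /g !nrm2.
have t0 x : 0 < x -> x < d -> 0 < t x.
  by move=> x0 xd; have := T_gt0 x0 (lt_le_trans xd dd0); rewrite ltcE => /andP[].
have f0 x : 0 <= f x by apply: sqr_ge0.
have g0 x : 0 <= g x by apply: sqr_ge0.
have h0 x : 0 <= h x by rewrite mulr_ge0 ?nrm_ge0.
have h2 x : h x ^+ 2 = f x * g x by rewrite /h exprMn.
have bnd z w u v : nrm u <= M -> nrm v <= M ->
    `|2 * complex.Re ((u * z + v * w) * Num.conj z)| <= 2 * M * (nrm z ^+ 2 + nrm z * nrm w).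
  move=> uM vM; rewrite normrM [`|2|]ger0_norm // -mulrA ler_wpM2l //.
  apply: le_trans (Re_le_nrm _) _; rewrite nrmM nrm_conj.
  have := nrmD (u * z) (v * w); rewrite !nrmM.
  have := nrm_ge0 z; have := nrm_ge0 w => w0 z0 /(ler_wpM2r z0)/le_trans; apply.
  have := ler_wpM2r z0 uM; have := ler_wpM2r w0 vM => vw uz.
  have := ler_wpM2r z0 (lerD uz vw).
  by move=> /le_trans; apply; rewrite le_eqVlt; apply/orP; left; apply/eqP; ring.
have al_le x : 0 < x -> x < d -> `|al x| <= 2 * M * (f x + h x).
  by move=> x0 xd; have [u1 u2 _ _] := eM x x0 xd; apply: bnd.
have be_le x : 0 < x -> x < d -> `|be x| <= 2 * M * (h x + g x).
  move=> x0 xd; have [_ _ u1 u2] := eM x x0 xd.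
  by rewrite /be (addrC (e21 x * _)) (addrC (h x)) /h (mulrC (nrm (p x))); apply: bnd.
have M20 : 0 <= 2 * M by rewrite mulr_ge0.
have [K [e [K0 e0 ed gK]]] : exists K e : R, [/\ 0 <= K, 0 < e, e <= d &
    forall x, 0 < x -> x < e -> g x <= K * x ^+ 2 * f x].
  case: minor_small => [n0|[K [e [K0 e0 rK]]]].
    have [K [e [K0 e0 ed gK]]] := minor_component_small d_gt0 M20
      Df Dg Dt t0 T_vanishes f0 g0 h0 h2 al_le be_le n0.
    by exists K, e; split=> //; apply: ltW.
  exists (K ^+ 2), (Num.min d e); rewrite sqr_ge0 lt_min d_gt0 ge_min lexx; split=> // x x0.
  rewrite lt_min => /andP[xd xe]; rewrite /f /g -!exprMn ler_sqr ?nnegrE ?nrm_ge0 //.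
    exact: rK.
  by rewrite mulr_ge0 ?nrm_ge0 // mulr_ge0 // ltW.
have sub x : x < e -> x < d by move=> xe; apply: lt_le_trans ed.
have [C [c [C0 c0 ce fgh]]] := @singular_ratios _ n e (2 * M) f g h t al be e0 M20
  (fun x px xe => Df x px (sub x xe)) (fun x px xe => Dg x px (sub x xe))
  (fun x px xe => Dt x px (sub x xe)) (fun x px xe => t0 x px (sub x xe)) T_vanishes f0 g0 h0 h2
  (fun x px xe => al_le x px (sub x xe)) (fun x px xe => be_le x px (sub x xe)) K K0 gK.
have TE x : 0 < x -> x < c -> T x = (t x)%:C.
  move=> x0 xc; rewrite RRe_real // gtr0_real // T_gt0 //.
  exact: lt_le_trans xc (le_trans ce (le_trans ed dd0)).
have t_nrm x : 0 < x -> x < c -> nrm (T x) = t x.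
  move=> x0 xc; apply: complexI; rewrite nrmE TE // ger0_norm // lecR ltW // t0 //.
  exact: lt_le_trans xc (le_trans ce ed).
have quot z x : 0 < x -> x < c -> nrm z / t x <= C -> `|z / T x| <= C%:C.
  move=> x0 xc zC; rewrite -nrm_le -(_ : nrm z / t x = nrm (z / T x)) //.
  by rewrite nrmM -(t_nrm x) //; congr (_ * _); apply: complexI; rewrite fmorphV /= !nrmE normfV.
split; exists c, C; split=> // x x0 xc; have [fC gC hC] := fgh x x0 xc.
- rewrite TE // [Num.conj _ * _]mulrC -nrm2C -fmorphV -rmorphM /=.
  rewrite (_ : (2 * n%:R + 1) / x%:C = ((2 * n%:R + 1) / x)%:C); last first.
    by rewrite rmorphM fmorphV /= rmorphD rmorphM /= !rmorph_nat rmorph1.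
  by rewrite -rmorphB normc_def /= expr0n addr0 sqrtr_sqr lecR.
- by apply: quot => //; rewrite nrmM nrm_conj -expr2.
- by apply: quot => //; rewrite nrmM nrm_conj.
- by apply: quot => //; rewrite nrmM nrm_conj (mulrC (nrm (r x))).
Qed.

End ComplexSingularSystem.

(** * Effect of removing one row on the residue of the potential *)

Section PoleStep.
Variable R : realType.
Implicit Types (x : R).

Lemma sum_I2 (V : nmodType) (F : 'I_2 -> V) : \sum_i F i = F 0 + F 1.
Proof. by rewrite !big_ord_recl big_ord0 addr0; congr (_ + F _); apply: val_inj. Qed.

Lemma matrix2P (T : Type) (A B : 'M[T]_2) :
  [/\ A 0 0 = B 0 0, A 0 1 = B 0 1, A 1 0 = B 1 0 & A 1 1 = B 1 1] -> A = B.
Proof.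
move=> [e00 e01 e10 e11]; apply/matrixP => i j.
have I2 (k : 'I_2) : k = 0 \/ k = 1.
  by case: k => [[|[|//]] ?]; [left|right]; apply: val_inj.
by case: (I2 i) => ->; case: (I2 j) => ->.
Qed.

(** This is $\breve JY\breve J^*-Y$, because $\breve J^*=-\breve J$. *)
Definition dressing_potential (Y : 'M[R[i]]_2) : 'M[R[i]]_2 := - (Jb *m Y *m Jb + Y).

Lemma dressing_potentialE Y : dressing_potential Y =
  mx22 (Y 1 1 - Y 0 0) (- (Y 0 1 + Y 1 0)) (- (Y 0 1 + Y 1 0)) (Y 0 0 - Y 1 1).
Proof.
by apply: matrix2P; split; rewrite !(mxE, sum_I2) /=; ring.
Qed.

Lemma dressing_potentialD Y Z :
  dressing_potential (Y + Z) = dressing_potential Y + dressing_potential Z.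
Proof. by rewrite /dressing_potential mulmxDr mulmxDl -opprD addrACA. Qed.

(** By [dressing_potentialE], these entries say that the potential of $Y$ is
    $(k/x)\sigma_3+O(1)$. *)
Definition simple_pole (k : R[i]) (Y : R -> 'M[R[i]]_2) : Prop :=
  bounded_near_zero (fun x => Y x 1 1 - Y x 0 0 - k / x%:C) /\
  bounded_near_zero (fun x => Y x 0 1 + Y x 1 0).

Section Step.
Variables (n : nat) (a : R[i]) (v : R -> 'rV[R[i]]_2) (T : R -> R[i]).
Variable Y : R -> 'M[R[i]]_2.
Hypothesis Dv : forall x, 0 < x ->
  is_derive_mx v x (- (a *: (v x *m Jb)) + v x *m dressing_potential (Y x)).
Hypothesis DT : forall x, 0 < x -> is_cderive T x ((v x *m (v x) ^t* ) 0 0).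
Hypothesis T_gt0 : forall x, 0 < x -> 0 < T x.
Hypothesis T_vanishes : vanishes_at0 (fun x => complex.Re (T x)).

(** The component of $v$ that behaves like $x^n$ is column $0$ for a positive residue and column $1$
    for a negative one. Its diagonal entry receives $(2n+1)/x$, which turns $\pm n$ into $\mp(n+1)$.
    For $n=0$ the sign [s] is not seen in the residue: it records which column is dominant. *)
Lemma pole_step (s : bool) : simple_pole ((-1) ^+ s * n%:R) Y ->
  (0 < n)%N \/ (exists K d : R, [/\ 0 <= K, 0 < d & forall x, 0 < x -> x < d ->
    nrm (v x 0 (if s then 0 else 1)) <= K * x * nrm (v x 0 (if s then 1 else 0))]) ->
  simple_pole ((-1) ^+ (~~ s) * n.+1%:R)
    (fun x => Y x + (T x)^-1 *: ((v x) ^t* *m v x)).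
Proof.
have D0 x : 0 < x -> is_cderive (fun t => v t 0 0) x
    (a * v x 0 1 + (Y x 1 1 - Y x 0 0) * v x 0 0 - (Y x 0 1 + Y x 1 0) * v x 0 1).
  move=> x0; have := Dv x0 0 0; rewrite dressing_potentialE.
  by rewrite !(mxE, sum_I2) /=; congr is_cderive; ring.
have D1 x : 0 < x -> is_cderive (fun t => v t 0 1) x
    (- a * v x 0 0 - (Y x 0 1 + Y x 1 0) * v x 0 0 - (Y x 1 1 - Y x 0 0) * v x 0 1).
  move=> x0; have := Dv x0 0 1; rewrite dressing_potentialE.
  by rewrite !(mxE, sum_I2) /=; congr is_cderive; ring.
have DT' x : 0 < x -> is_cderive T x
    (v x 0 0 * Num.conj (v x 0 0) + v x 0 1 * Num.conj (v x 0 1)).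
  by move=> x0; have := DT x0; rewrite !(mxE, sum_I2).
have ba := bounded_near_zero_cst a.
move=> [bY bZ] minor.
have baZ := bounded_near_zeroD ba (bounded_near_zeroN bZ).
have bNaZ := bounded_near_zeroD (bounded_near_zeroN ba) (bounded_near_zeroN bZ).
have bNY := bounded_near_zeroN bY.
have Y'E (i j : 'I_2) x : (Y x + (T x)^-1 *: ((v x) ^t* *m v x)) i j =
    Y x i j + Num.conj (v x 0 i) * v x 0 j / T x.
  by rewrite !(mxE, big_ord1) mulrC.
have bD := @bounded_near_zeroD R R[i].
have bN := @bounded_near_zeroN R R[i].
have beq f g : (forall x : R, 0 < x -> f x = g x) -> bounded_near_zero f ->
    @bounded_near_zero R R[i] g.
  by move=> fg; apply: (bounded_near_zero_eq ltr01) => x x0 _; apply: fg.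
have n1 : n.+1%:R = n%:R + 1 :> R[i] by rewrite -natr1.
case: s minor bY bNY => minor; rewrite !(expr0, expr1) ?mul1r ?mulN1r => bY bNY.
(* For negative residue the columns exchange roles: column $1$ is the growing one. *)
- case: (@singular_system_ratios R n 1 (fun x => v x 0 1) (fun x => v x 0 0) T
    _ _ _ _ ltr01 _ _ _ _ T_vanishes bNY bNaZ baZ bY minor).
  + by move=> x x0 _; have := D1 x x0; congr is_cderive; ring.
  + by move=> x x0 _; have := D0 x x0; congr is_cderive; ring.
  + by move=> x x0 _; have := DT' x x0; congr is_cderive; ring.
  + by move=> x x0 _; apply: T_gt0.
  move=> b1 b2 b3 b4; split.
    apply: beq (bD _ _ (bD _ _ bY b1) (bN _ b2)) => x x0.
    by rewrite !Y'E n1 mulNr; ring.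
  apply: beq (bD _ _ (bD _ _ bZ b3) b4) => x x0.
  by rewrite !Y'E; ring.
- case: (@singular_system_ratios R n 1 (fun x => v x 0 0) (fun x => v x 0 1) T
    _ _ _ _ ltr01 _ _ _ _ T_vanishes bY baZ bNaZ bNY minor).
  + by move=> x x0 _; have := D0 x x0; congr is_cderive; ring.
  + by move=> x x0 _; have := D1 x x0; congr is_cderive; ring.
  + by move=> x x0 _; have := DT' x x0; congr is_cderive; ring.
  + by move=> x x0 _; apply: T_gt0.
  move=> b1 b2 b3 b4; split.
    apply: beq (bD _ _ (bD _ _ bY b2) (bN _ b1)) => x x0.
    by rewrite !Y'E n1; ring.
  apply: beq (bD _ _ (bD _ _ bZ b3) b4) => x x0.
  by rewrite !Y'E; ring.
Qed.

End Step.
End PoleStep.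

(** * Schur complements of dressing data *)

Section PositiveDefinite.
Variable R : realType.
Implicit Types n : nat.

Lemma posdefmx_ge0 n (M : 'M[R[i]]_n) (v : 'cV[R[i]]_n) :
  posdefmx M -> 0 <= (v ^t* *m M *m v) 0 0.
Proof.
move=> [_ Mpos]; have [->|v0] := eqVneq v 0; last exact/ltW/Mpos.
by rewrite mulmx0 mxE.
Qed.

Lemma posdefmx_congr n k (M : 'M[R[i]]_n) (B : 'M[R[i]]_(n, k)) :
  posdefmx M -> (forall v : 'cV[R[i]]_k, B *m v = 0 -> v = 0) ->
  posdefmx (B ^t* *m M *m B).
Proof.
move=> [/hermsymmxP Mh Mpos] Binj; split=> [|v v0].
  by apply/hermsymmxP; rewrite !adjmxM trmxCK Mh mulmxA.
have := Mpos (B *m v); rewrite adjmxM !mulmxA; apply.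
by apply: contra_neq v0; apply: Binj.
Qed.

Lemma posdefmx_unit n (M : 'M[R[i]]_n) : posdefmx M -> M \in unitmx.
Proof.
move=> [_ Mpos]; rewrite unitmxE unitfE; apply/negP => /det0P[v v0 vM].
have := Mpos (v ^t* ); rewrite trmxCK vM mul0mx mxE ltxx.
have v'0 : v ^t* != 0 by apply: contra_neq v0 => v'0; rewrite -(trmxCK v) v'0 adjmx0.
by move=> /(_ v'0).
Qed.

Lemma posdefmx_adj n (M : 'M[R[i]]_n) : posdefmx M -> M ^t* = M.
Proof. by move=> [/hermsymmxP]. Qed.

End PositiveDefinite.

Section Dressing.
Variable R : realType.

(** [Q] is the potential produced by the rows already eliminated. The relations are stated at one
    point so that they can be used at $x=0$ too, where $T$ need not be invertible. *)
Definition dressing_at n (A : 'M[R[i]]_n) (P : R -> 'M[R[i]]_(n, 2))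
    (T : R -> 'M[R[i]]_n) (Q : 'M[R[i]]_2) (x : R) : Prop :=
  [/\ is_derive_mx P x (- (A *m P x *m Jb) + P x *m Q),
      is_derive_mx T x (P x *m (P x) ^t* ),
      A *m T x - T x *m A ^t* = P x *m Jb *m (P x) ^t* &
      (T x) ^t* = T x].

Section SchurComplement.
Variables (n1 n2 : nat) (P : R -> 'M[R[i]]_(n1 + n2, 2)) (T : R -> 'M[R[i]]_(n1 + n2)).

(** The lower block row of the unitriangular elimination matrix; multiplying $T$ by it on the left
    kills the first block column. *)
Definition schur_row x : 'M[R[i]]_(n2, n1 + n2) :=
  row_mx (- (dlsubmx (T x) *m invmx (ulsubmx (T x)))) 1%:M.
Definition schurP x : 'M[R[i]]_(n2, 2) := schur_row x *m P x.
Definition schurT x : 'M[R[i]]_n2 := schur_row x *m T x *m (schur_row x) ^t*.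

Lemma schurPE x :
  schurP x = dsubmx (P x) - dlsubmx (T x) *m invmx (ulsubmx (T x)) *m usubmx (P x).
Proof. by rewrite /schurP -{1}[P x]vsubmxK mul_row_col mul1mx mulNmx addrC. Qed.

Variable x : R.
Hypothesis Th : (T x) ^t* = T x.

Lemma hermitian_blocks : [/\ (ulsubmx (T x)) ^t* = ulsubmx (T x),
  ursubmx (T x) = (dlsubmx (T x)) ^t* & (drsubmx (T x)) ^t* = drsubmx (T x)].
Proof.
have := Th; rewrite -{1}[T x]submxK adjmx_block -{5}[T x]submxK.
by move=> /eq_block_mx[? ? ? ?].
Qed.

Hypothesis T11 : ulsubmx (T x) \in unitmx.

Lemma schur_row_mul : schur_row x *m T x = row_mx 0 (schurT x).
Proof.
have [h1 h2 h3] := hermitian_blocks.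
have LT : schur_row x *m T x = row_mx 0
    (drsubmx (T x) - dlsubmx (T x) *m invmx (ulsubmx (T x)) *m ursubmx (T x)).
  rewrite /schur_row -{3}[T x]submxK mul_row_block !mul1mx !mulNmx mulmxKV //.
  by rewrite addNr addrC.
rewrite /schurT LT; congr row_mx.
by rewrite /schur_row adjmx_row mul_row_col mul0mx add0r adjmx1 mulmx1.
Qed.

Lemma schurT_adj : (schurT x) ^t* = schurT x.
Proof. by rewrite /schurT !adjmxM trmxCK Th mulmxA. Qed.

Lemma schur_row_muladj : T x *m (schur_row x) ^t* = col_mx 0 (schurT x).
Proof. by rewrite -{1}Th -adjmxM schur_row_mul adjmx_row adjmx0 schurT_adj. Qed.

Lemma schurTE : schurT x = drsubmx (T x) -
  dlsubmx (T x) *m invmx (ulsubmx (T x)) *m (dlsubmx (T x)) ^t*.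
Proof.
have [h1 h2 h3] := hermitian_blocks.
have := schur_row_mul; rewrite /schur_row -{3}[T x]submxK mul_row_block => /eq_row_mx[_ <-].
by rewrite mul1mx mulNmx addrC h2.
Qed.

Variables (A1 : 'M[R[i]]_n1) (R0 : 'M[R[i]]_(n2, n1)) (A2 : 'M[R[i]]_n2) (Q : 'M[R[i]]_2).

Definition leading_form s : 'M[R[i]]_2 :=
  (usubmx (P s)) ^t* *m invmx (ulsubmx (T s)) *m usubmx (P s).

(** Write $L$ for the elimination row, $p=LP$ and $X_1$ for the leading form. Then $L'P=-pX_1$ and
    $LAP=p\breve JX_1+A_2p$; the two terms in $X_1$ add up to $p(-X_1-\breve JX_1\breve J)$, the
    potential of $X_1$ acting on $p$. *)
Lemma schur_dressing : dressing_at (block_mx A1 0 R0 A2) P T Q x ->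
  dressing_at A2 schurP schurT (Q + dressing_potential (leading_form x)) x.
Proof.
move=> [DP DT AT _]; set A := block_mx A1 0 R0 A2.
pose L := schur_row x; pose C := dlsubmx (T x) *m invmx (ulsubmx (T x)).
pose Cd := schurP x *m (usubmx (P x)) ^t* *m invmx (ulsubmx (T x)).
have PP : P x *m (P x) ^t* = block_mx (usubmx (P x) *m (usubmx (P x)) ^t* )
    (usubmx (P x) *m (dsubmx (P x)) ^t* ) (dsubmx (P x) *m (usubmx (P x)) ^t* )
    (dsubmx (P x) *m (dsubmx (P x)) ^t* ).
  by rewrite -{1 2}[P x]vsubmxK adjmx_col mul_col_row.
have DC : is_derive_mx (fun s => dlsubmx (T s) *m invmx (ulsubmx (T s))) x Cd.
  have := is_derive_mxM (is_derive_mx_dlsub DT) (is_derive_mxV (is_derive_mx_ulsub DT) T11).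
  rewrite PP block_mxKul block_mxKdl; congr is_derive_mx.
  by rewrite /Cd schurPE !mulmxBl mulmxN !mulmxA.
have DL : is_derive_mx schur_row x (row_mx (- Cd) 0).
  exact: is_derive_mx_row (is_derive_mxN DC) (is_derive_mx_cst _ _).
(* The identity for $AT-TA^*$, multiplied by $L$ on the left, is solved for the first block of $LA$
   by comparing first block columns. *)
have LA : L *m A = row_mx
    (schurP x *m Jb *m (usubmx (P x)) ^t* *m invmx (ulsubmx (T x)) - A2 *m C) A2.
  have : L *m A *m T x - L *m T x *m A ^t* = schurP x *m Jb *m (P x) ^t*.
    by rewrite -!mulmxA -mulmxBr AT !mulmxA.
  have -> : L *m A = row_mx (- (C *m A1) + R0) A2.
    by rewrite /L /schur_row /A mul_row_block mulNmx !mul1mx mulmx0 add0r.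
  rewrite /L schur_row_mul -{1}[T x]submxK mul_row_block adjmx_block mul_row_block.
  have -> : (P x) ^t* = row_mx ((usubmx (P x)) ^t* ) ((dsubmx (P x)) ^t* ).
    by rewrite -{1}[P x]vsubmxK adjmx_col.
  rewrite mul_mx_row !mul0mx add0r adjmx0 mulmx0 opp_row_mx add_row_mx oppr0 addr0.
  move=> /eq_row_mx[LA1 _]; congr row_mx.
  by rewrite -LA1 mulmxDl mulmxK // -mulmxA -/C addrK.
have LAP : L *m A *m P x = schurP x *m Jb *m leading_form x + A2 *m schurP x.
  rewrite LA -{2}[P x]vsubmxK mul_row_col mulmxBl -addrA -mulNmx.
  congr (_ + _); first by rewrite /leading_form !mulmxA.
  by rewrite schurPE mulmxBr addrC mulNmx !mulmxA.
split.
- have h1 : row_mx (- Cd) (0 : 'M[R[i]]_n2) *m P x = - (schurP x *m leading_form x).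
    rewrite -{1}[P x]vsubmxK mul_row_col mul0mx addr0 mulNmx.
    by rewrite /Cd /leading_form !mulmxA.
  have h2 : L *m (A *m P x *m Jb) =
      schurP x *m (Jb *m leading_form x *m Jb) + A2 *m schurP x *m Jb.
    by rewrite !mulmxA LAP mulmxDl !mulmxA.
  have aux (a b c e : 'M[R[i]]_(n2, 2)) : - a + (- (b + c) + e) = - c + (e - (b + a)).
    by apply/matrixP => i j; rewrite !mxE; ring.
  have E : row_mx (- Cd) 0 *m P x + L *m (- (A *m P x *m Jb) + P x *m Q) =
      - (A2 *m schurP x *m Jb) + schurP x *m (Q + dressing_potential (leading_form x)).
    rewrite h1 mulmxDr mulmxN h2 (mulmxA L) -/(schurP x) aux.
    by rewrite -mulmxDr -mulmxBr.
  by rewrite -E; apply: is_derive_mxM DL DP.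
(* Differentiating $L$ contributes nothing to the derivative of $LTL^*$: $L'$ has only a left block,
   and $TL^*$ has only a lower one. *)
- have e1 : row_mx (- Cd) (0 : 'M[R[i]]_n2) *m (T x *m L ^t* ) = 0.
    by rewrite schur_row_muladj mul_row_col mulmx0 mul0mx addr0.
  have e2 : L *m T x *m (row_mx (- Cd) (0 : 'M[R[i]]_n2)) ^t* = 0.
    by rewrite schur_row_mul adjmx_row mul_row_col adjmx0 mul0mx mulmx0 addr0.
  have -> : schurP x *m (schurP x) ^t* =
      (row_mx (- Cd) 0 *m T x + L *m (P x *m (P x) ^t* )) *m L ^t* +
      L *m T x *m (row_mx (- Cd) 0) ^t*.
    by rewrite e2 addr0 mulmxDl -(mulmxA (row_mx (- Cd) 0) (T x)) e1 add0r /schurP adjmxM !mulmxA.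
  exact: is_derive_mxM (is_derive_mxM DL DT) (is_derive_mx_adj DL).
- have : L *m A *m (T x *m L ^t* ) - (L *m T x) *m (L *m A) ^t* = schurP x *m Jb *m (schurP x) ^t*.
    by rewrite /schurP !adjmxM -!mulmxA -mulmxBr !mulmxA -mulmxBl AT !mulmxA.
  rewrite schur_row_muladj schur_row_mul LA adjmx_row !mul_row_col mulmx0 mul0mx !add0r.
  exact.
- exact: schurT_adj.
Qed.

Lemma leading_dressing : dressing_at (block_mx A1 0 R0 A2) P T Q x ->
  is_derive_mx (fun s => usubmx (P s)) x
    (- (A1 *m usubmx (P x) *m Jb) + usubmx (P x) *m Q) /\
  is_derive_mx (fun s => ulsubmx (T s)) x (usubmx (P x) *m (usubmx (P x)) ^t* ).
Proof.
move=> [DP DT _ _]; split=> [i j|].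
  have -> : - (A1 *m usubmx (P x) *m Jb) + usubmx (P x) *m Q =
      usubmx (- (block_mx A1 0 R0 A2 *m P x *m Jb) + P x *m Q).
    rewrite -{3 4}[P x]vsubmxK mul_block_col mul0mx addr0 !mul_col_mx opp_col_mx add_col_mx.
    by rewrite col_mxKu.
  rewrite mxE; apply: is_cderive_ext (DP (lshift n2 i) j) => s; by rewrite mxE.
have := is_derive_mx_ulsub DT.
by rewrite -{1 2}[P x]vsubmxK adjmx_col mul_col_row block_mxKul.
Qed.

(** The factorization $T=VDV^*$, with $D$ block diagonal and $V$ unitriangular, gives
    $T^{-1}=U^*D^{-1}U$ for $U=V^{-1}$, and $UP$ stacks the upper block of $P$ over its Schur
    complement. *)
Lemma quadratic_form_schur : schurT x \in unitmx ->
  (P x) ^t* *m invmx (T x) *m P x =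
  leading_form x + (schurP x) ^t* *m invmx (schurT x) *m schurP x.
Proof.
move=> T2; pose C := dlsubmx (T x) *m invmx (ulsubmx (T x)).
have [h1 h2 h3] := hermitian_blocks.
pose U : 'M[R[i]]_(n1 + n2) := block_mx 1%:M 0 (- C) 1%:M.
pose V : 'M[R[i]]_(n1 + n2) := block_mx 1%:M 0 C 1%:M.
pose D := block_mx (ulsubmx (T x)) 0 0 (schurT x).
pose E := block_mx (invmx (ulsubmx (T x))) 0 0 (invmx (schurT x)).
have UV : U *m V = 1%:M.
  rewrite /U /V mulmx_block !mul1mx !mulmx1 !mul0mx !mulmx0 !addr0 add0r addNr.
  by rewrite -scalar_mx_block.
have VU : V *m U = 1%:M by apply: mulmx1C.
have DE : D *m E = 1%:M.
  rewrite /D /E mulmx_block !mul0mx !mulmx0 !addr0 !add0r !mulmxV //.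
  by rewrite -scalar_mx_block.
have TE : T x = V *m D *m V ^t*.
  rewrite /V /D adjmx_block !adjmx1 adjmx0 !mulmx_block !mul1mx !mulmx1 !mul0mx !mulmx0.
  rewrite !addr0 !add0r -{1}[T x]submxK /C mulmxKV // adjmxM adjmx_inv h1 -h2.
  by rewrite mulKVmx // schurTE -h2 mulmxA addrC subrK.
have TW : T x *m (U ^t* *m E *m U) = 1%:M.
  rewrite TE !mulmxA -(mulmxA _ (V ^t* )) -adjmxM UV adjmx1 mulmx1.
  by rewrite -(mulmxA V) DE mulmx1.
have [Tu _] := mulmx1_unit TW.
have -> : invmx (T x) = U ^t* *m E *m U.
  by rewrite -[LHS]mulmx1 -TW mulKmx.
have UP : U *m P x = col_mx (usubmx (P x)) (schurP x).
  rewrite /U -{1}[P x]vsubmxK mul_block_col !mul1mx mul0mx addr0 mulNmx.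
  by rewrite addrC schurPE.
rewrite !mulmxA -adjmxM -mulmxA UP adjmx_col mul_row_block !mulmx0 addr0 add0r.
by rewrite mul_row_col /schurP !mulmxA.
Qed.

End SchurComplement.

Lemma schurT_posdef n1 n2 (T : R -> 'M[R[i]]_(n1 + n2)) x :
  posdefmx (T x) -> posdefmx (ulsubmx (T x)) /\ posdefmx (schurT T x).
Proof.
move=> Tp; split.
  have := @posdefmx_congr R _ _ (T x) (col_mx (1%:M : 'M[R[i]]_n1) 0) Tp.
  rewrite adjmx_col adjmx1 adjmx0 -{1}[T x]submxK mul_row_block !mul1mx !mul0mx !addr0.
  rewrite mul_row_col mulmx1 mulmx0 addr0; apply=> v.
  by rewrite mul_col_mx mul1mx => /eqP; rewrite col_mx_eq0 => /andP[/eqP].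
have := @posdefmx_congr R _ _ (T x) ((schur_row T x) ^t* ) Tp.
rewrite trmxCK; apply=> v.
by rewrite adjmx_row adjmx1 mul_col_mx mul1mx => /eqP; rewrite col_mx_eq0 => /andP[_ /eqP].
Qed.

(** Each diagonal entry of the Schur complement is that of $T$ minus a value of the positive form of
    the leading block. *)
Lemma schurT_vanishes n1 n2 (T : R -> 'M[R[i]]_(n1 + n2)) :
  (forall x, 0 < x -> posdefmx (T x)) ->
  (forall i, vanishes_at0 (fun x => complex.Re (T x i i))) ->
  forall i, vanishes_at0 (fun x => complex.Re (schurT T x i i)).
Proof.
move=> Tp T0 i e e0; have [d d0 Td] := T0 (rshift n1 i) e e0; exists d => // x x0 xd.
apply: le_lt_trans (Td x x0 xd); have [Tp1 _] := schurT_posdef (Tp x x0).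
have T1 := posdefmx_unit Tp1.
have Th := posdefmx_adj (Tp x x0); have [h1 _ _] := hermitian_blocks Th.
pose C := dlsubmx (T x) *m invmx (ulsubmx (T x)).
have CT : C *m (dlsubmx (T x)) ^t* = C *m ulsubmx (T x) *m C ^t*.
  by rewrite -{1}(mulmxKV T1 (dlsubmx (T x))) -/C adjmxM h1 mulmxA.
have := posdefmx_ge0 ((row i C) ^t* ) Tp1; rewrite trmxCK lecE => /andP[_ C0].
have -> : schurT T x i i = T x (rshift n1 i) (rshift n1 i) -
    (row i C *m ulsubmx (T x) *m (row i C) ^t* ) 0 0.
  have subE (A B : 'M[R[i]]_n2) : (A - B) i i = A i i - B i i by rewrite !mxE.
  rewrite schurTE // -/C CT subE; congr (_ - _).
    by rewrite !mxE.
  by rewrite -row_mul !mxE; apply: eq_bigr => j _; rewrite !mxE.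
by rewrite raddfB /= gerBl.
Qed.

End Dressing.

(** * Elimination of all rows of a triangular block *)

Section DressingPoles.
Variable R : realType.

(** The substitute for [minor_component_small] on the first row, where there is no pole yet. *)
Definition minor_small (s : bool) (v : R -> 'rV[R[i]]_2) : Prop :=
  exists K d : R, [/\ 0 <= K, 0 < d & forall x, 0 < x -> x < d ->
    nrm (v x 0 (if s then 0 else 1)) <= K * x * nrm (v x 0 (if s then 1 else 0))].

Lemma simple_pole_ext k (Y Z : R -> 'M[R[i]]_2) :
  (forall x, 0 < x -> Y x = Z x) -> simple_pole k Y -> simple_pole k Z.
Proof.
by move=> YZ [b1 b2]; split; [apply: bounded_near_zero_eq ltr01 _ b1|
  apply: bounded_near_zero_eq ltr01 _ b2] => x x0 _; rewrite YZ.
Qed.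

(** Induction on the number of rows: [Y] collects the forms already split off, and each row raises
    [n] by one and flips [s], hence the parity of [k] in the result. The condition on the first row
    is met automatically after one step, as [n] is then positive. *)
Lemma dressing_poles (k n : nat) (s : bool) (A : 'M[R[i]]_k) (P : R -> 'M[R[i]]_(k, 2))
    (T : R -> 'M[R[i]]_k) (Y : R -> 'M[R[i]]_2) :
  is_trig_mx A ->
  (forall x, 0 < x -> dressing_at A P T (dressing_potential (Y x)) x) ->
  (forall x, 0 < x -> posdefmx (T x)) ->
  (forall i, vanishes_at0 (fun x => complex.Re (T x i i))) ->
  simple_pole ((-1) ^+ s * n%:R) Y ->
  (forall i : 'I_k, val i = 0%N -> (0 < n)%N \/ minor_small s (fun x => row i (P x))) ->
  simple_pole ((-1) ^+ (s (+) odd k) * (n + k)%:R)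
    (fun x => Y x + (P x) ^t* *m invmx (T x) *m P x).
Proof.
elim: k n s A P T Y => [|k IHk] n s A P T Y trigA DP Tp T0 poleY minor.
  rewrite addbF addn0; apply: simple_pole_ext poleY => x x0.
  rewrite (_ : _ *m P x = 0) ?addr0 //.
  by rewrite [P x]flatmx0 mulmx0.
(* Triangularity isolates the first row: its equation involves no later row. *)
have AE : A = block_mx (ulsubmx (A : 'M[R[i]]_(1 + k))) 0
    (dlsubmx (A : 'M[R[i]]_(1 + k))) (drsubmx (A : 'M[R[i]]_(1 + k))).
  have A0 : ursubmx (A : 'M[R[i]]_(1 + k)) = 0.
    apply/matrixP => i j; rewrite !mxE.
    by move/is_trig_mxP: trigA; apply; rewrite /= ord1.
  by rewrite -[X in block_mx _ X]A0 submxK.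
set A1 := ulsubmx _ in AE; set R0 := dlsubmx _ in AE; set A2 := drsubmx _ in AE.
have trigA2 : is_trig_mx A2.
  apply/is_trig_mxP => i j ij; rewrite !mxE.
  by move/is_trig_mxP: trigA; apply; rewrite /= ltnS.
rewrite AE in DP.
pose P' := P : R -> 'M[R[i]]_(1 + k, 2); pose T' := T : R -> 'M[R[i]]_(1 + k).
pose v x := usubmx (P' x); pose t x := ulsubmx (T' x) 0 0.
have Th x : 0 < x -> (T' x) ^t* = T' x by move=> x0; apply: posdefmx_adj (Tp x x0).
have Tsp x (x0 : 0 < x) := @schurT_posdef R 1 k T' x (Tp x x0).
have tE x : ulsubmx (T' x) = (t x)%:M by rewrite -mx11_scalar.
have t0 x : 0 < x -> 0 < t x.
  move=> x0; have [[_ Tpos] _] := Tsp x x0; have := Tpos 1%:M.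
  rewrite adjmx1 mul1mx mulmx1 => H; apply: H.
  by apply/eqP => /matrixP/(_ 0 0) /eqP; rewrite !mxE oner_eq0.
have lfE x : leading_form P' T' x = (t x)^-1 *: ((v x) ^t* *m v x).
  by rewrite /leading_form tE invmx_scalar mul_mx_scalar -scalemxAl.
have Dvt x (x0 : 0 < x) := @leading_dressing R 1 k P' T' x A1 R0 A2 _ (DP x x0).
have pole1 : simple_pole ((-1) ^+ (~~ s) * n.+1%:R) (fun x => Y x + leading_form P' T' x).
  apply: (@simple_pole_ext _ (fun x => Y x + (t x)^-1 *: ((v x) ^t* *m v x))).
    by move=> x x0; rewrite lfE.
  apply: (@pole_step R n (A1 0 0) v t) => //.
  - move=> x x0; have [D _] := Dvt x x0; rewrite scalemxAl -mul_scalar_mx -mx11_scalar.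
    exact: D.
  - by move=> x x0; have [_ D] := Dvt x x0; apply: is_cderive_ext (D 0 0).
  - move=> e e0; have [d d0 Td] := T0 0 e e0; exists d => // x x0 xd.
    rewrite /t mxE mxE (_ : lshift k 0 = 0); first exact: Td.
    exact: val_inj.
  - have [|[K [d [K0 d0 vK]]]] := minor 0 erefl; [by left|right].
    exists K, d; split=> // x x0 xd; have := vK x x0 xd.
    by rewrite !mxE (_ : lshift k 0 = 0) //; apply: val_inj.
have := IHk n.+1 (~~ s) A2 (schurP P' T') (schurT T') _ trigA2 _ _ _ pole1 _.
rewrite addSnnS (_ : ~~ s (+) odd k = s (+) odd k.+1); last by rewrite /= addNb addbN.
move=> H; apply: simple_pole_ext (H _ _ _ _) => [x x0||||]; last by left.
- rewrite -addrA -quadratic_form_schur ?posdefmx_unit //;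
    [exact: Th|exact: (Tsp _ x0).1|exact: (Tsp _ x0).2].
- move=> x x0; rewrite dressing_potentialD.
  exact: (@schur_dressing R 1 k P' T' x (Th x x0)
    (posdefmx_unit (Tsp _ x0).1) A1 R0 A2 _ (DP x x0)).
- by move=> x x0; apply: (Tsp _ x0).2.
- exact: schurT_vanishes.
Qed.

End DressingPoles.

(** * The regular block *)

Section LinearBounds.
Variable R : realType.

Lemma is_derive_linear_bound (h : R -> R) (a : R) : is_derive (0 : R) 1 h a -> h 0 = 0 ->
  exists K d : R, [/\ 0 <= K, 0 < d & forall x, 0 < x -> x < d -> `|h x| <= K * x].
Proof.
move=> [dh ha] h0.
have : (fun u : R => u^-1 *: ((h \o shift 0) (u *: 1) - h 0)) @ 0^' --> a by rewrite -ha.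
move=> /cvgrPdist_lt /(_ 1 ltr01) /nbhs_ballP[d /= d0 hd].
exists (`|a| + 1), d; split=> // x x0 xd.
have : `|a - x^-1 * h x| < 1.
  have := hd x; rewrite /ball /= sub0r normrN gtr0_norm // => /(_ xd).
  by rewrite gt_eqF // /GRing.scale /= mulr1 addr0 h0 subr0; apply.
move=> ah; have : `|x^-1 * h x| <= `|a| + 1.
  rewrite -[x^-1 * h x](subKr a); apply: le_trans (ler_normB _ _) _.
  by rewrite lerD2l ltW.
by rewrite normrM gtr0_norm ?invr_gt0 // mulrC ler_pdivrMr.
Qed.

Lemma is_cderive_linear_bound (f : R -> R[i]) d : is_cderive f 0 d -> f 0 = 0 ->
  exists K e : R, [/\ 0 <= K, 0 < e & forall x, 0 < x -> x < e -> nrm (f x) <= K * x].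
Proof.
move=> [f1 f2] f0.
have [|K1 [d1 [K10 d10 K1f]]] := is_derive_linear_bound f1; first by rewrite f0.
have [|K2 [d2 [K20 d20 K2f]]] := is_derive_linear_bound f2; first by rewrite f0.
exists (K1 + K2), (Num.min d1 d2); rewrite addr_ge0 // lt_min d10; split=> // x x0.
rewrite lt_min => /andP[xd1 xd2].
rewrite [f x]complexE; apply: le_trans (nrmD _ _) _; rewrite nrmM mulrDl lerD //.
  by rewrite nrm_le normc_def /= expr0n addr0 sqrtr_sqr lecR K1f.
rewrite (_ : nrm 'i = 1); last first.
  by apply: complexI; rewrite nrmE normc_def /= expr0n expr1n add0r sqrtr1.
by rewrite mul1r nrm_le normc_def /= expr0n addr0 sqrtr_sqr lecR K2f.
Qed.

Lemma is_cderive_sub_linear_bound (f : R -> R[i]) d : is_cderive f 0 d ->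
  exists K e : R, [/\ 0 <= K, 0 < e & forall x, 0 < x -> x < e -> nrm (f x - f 0) <= K * x].
Proof.
move=> fd; apply: is_cderive_linear_bound (is_cderiveD fd (is_cderive_cst (- f 0) 0)) _.
by rewrite subrr.
Qed.

Lemma is_cderive_bounded (f : R -> R[i]) d : is_cderive f 0 d -> bounded_near_zero f.
Proof.
move=> /is_cderive_sub_linear_bound[K [e [K0 e0 fK]]].
have := bounded_near_zeroD (f := fun x => f x - f 0) _ (bounded_near_zero_cst (f 0)).
move=> H; apply: (bounded_near_zero_eq ltr01 _ (H _)) => [x _ _|]; first by rewrite subrK.
exists (Num.min e 1), K; rewrite lt_min e0 ltr01; split=> // x x0.
rewrite lt_min => /andP[xe x1]; rewrite -nrm_le (le_trans (fK x x0 xe)) //.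
by rewrite ler_piMr // ltW.
Qed.

Lemma is_cderive_vanishes (f : R -> R[i]) d : is_cderive f 0 d -> f 0 = 0 ->
  vanishes_at0 (fun x => complex.Re (f x)).
Proof.
move=> fd f0 e e0; have [K [c [K0 c0 fK]]] := is_cderive_linear_bound fd f0.
have K1 : 0 < K + 1 by rewrite ltr_wpDl.
exists (Num.min c (e / (K + 1))); first by rewrite lt_min c0 divr_gt0.
move=> x x0; rewrite lt_min => /andP[xc]; rewrite ltr_pdivlMr // => xe.
apply: le_lt_trans (ler_norm _) (le_lt_trans (Re_le_nrm _) _).
apply: le_lt_trans (fK x x0 xc) _; apply: le_lt_trans xe.
by rewrite mulrC ler_wpM2l ?(ltW x0) // lerDl.
Qed.

(** One component vanishes at zero and is thus $O(x)$; the other starts at $c\ne0$ and keeps modulus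
    at least $|c|/2$ nearby. *)
Lemma regular_minor_small (s : bool) (v : R -> 'rV[R[i]]_2) D (c : R[i]) :
  is_derive_mx v 0 D -> c != 0 -> v 0 = c *: delta_mx 0 (if s then 1 else 0) ->
  minor_small s v.
Proof.
move=> vD c0 v0.
pose f x := v x 0 (if s then 0 else 1); pose g x := v x 0 (if s then 1 else 0).
have f0 : f 0 = 0 by rewrite /f v0 !mxE; case: s {v0 f g}; rewrite /= mulr0.
have g0 : g 0 = c by rewrite /g v0 !mxE; case: s {v0 f g f0}; rewrite /= mulr1.
have [K [d [K0 d0 fK]]] := is_cderive_linear_bound (vD 0 (if s then 0 else 1)) f0.
have [L [e [L0 e0 gL]]] := is_cderive_sub_linear_bound (vD 0 (if s then 1 else 0)).
have c1 : 0 < nrm c by rewrite -ltcR nrmE normr_gt0.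
have L1 : 0 < 2 * L + 1 by rewrite ltr_wpDl // mulr_ge0.
(* The last radius gives $Lx<|c|/2$, and $Kx=(2K/|c|)\,x\,(|c|/2)$. *)
exists (2 * K / nrm c), (Num.min d (Num.min e (nrm c / (2 * L + 1)))).
rewrite !lt_min d0 e0 !divr_gt0 //; split=> //.
  by rewrite divr_ge0 ?mulr_ge0 // ltW.
move=> x x0; rewrite !lt_min => /and3P[xd xe]; rewrite ltr_pdivlMr // => xc.
apply: le_trans (fK x x0 xd) _.
have := gL x x0 xe; rewrite -/(g x) -/(g 0) g0 => gx.
have cg : nrm c / 2 <= nrm (g x).
  have := nrmD (g x) (c - g x); rewrite addrC subrK.
  rewrite (_ : nrm (c - g x) = nrm (g x - c)); last first.
    by apply: complexI; rewrite !nrmE distrC.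
  by move=> h; move: xc; rewrite mulrDr; lra.
rewrite [leLHS](_ : _ = 2 * K / nrm c * x * (nrm c / 2)); last by field; rewrite gt_eqF.
by rewrite ler_wpM2l // !mulr_ge0 ?invr_ge0 // ltW.
Qed.

End LinearBounds.

(** * Dressing data of the theorem *)

Section PauliAlgebra.
Variable R : realType.
Implicit Types z : R[i].

(* In [Defs], ['i] denotes [Num.imaginary] where the scope is [ring_scope], and
   the pair [0 +i* 1] where it is [complex_scope]. *)
Lemma imaginaryE : Num.imaginary = 'i%C :> R[i].
Proof. by []. Qed.

Lemma JbJb : Jb *m Jb = - 1%:M :> 'M[R[i]]_2.
Proof. by apply: matrix2P; split; rewrite !(mxE, sum_I2) /=; ring. Qed.

Lemma Jb_adj : Jb ^t* = - Jb :> 'M[R[i]]_2.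
Proof.
by apply: matrix2P; split; rewrite !mxE /= ?rmorph0 ?rmorph1 ?rmorphN1 ?oppr0 ?opprK.
Qed.

Lemma sqrt2V_conj : Num.conj (((Num.sqrt 2)^-1)%:C : R[i]) = ((Num.sqrt 2)^-1)%:C.
Proof. by rewrite conjCE /= oppr0. Qed.

Lemma sqrt2V_sqr : ((Num.sqrt 2)^-1)%:C * ((Num.sqrt 2)^-1)%:C = 2^-1 :> R[i].
Proof. by rewrite -rmorphM /= -invfM -expr2 sqr_sqrtr // fmorphV /= rmorph_nat. Qed.

Lemma Kb_adj : Kb ^t* = ((Num.sqrt 2)^-1)%:C *: mx22 1 'i%C 1 (- 'i%C) :> 'M[R[i]]_2.
Proof.
apply: matrix2P; split; rewrite !mxE /= rmorphM /= sqrt2V_conj ?rmorph1 //;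
  congr (_ * _); rewrite ?imaginaryE ?conjCE.
  by apply/eqP; rewrite eq_complex /= !oppr0 opprK !eqxx.
by apply/eqP; rewrite eq_complex /= !oppr0 !eqxx.
Qed.

Lemma Kb_unitary : Kb *m Kb ^t* = 1%:M :> 'M[R[i]]_2.
Proof.
rewrite Kb_adj /Kb -scalemxAl -scalemxAr scalerA sqrt2V_sqr.
have i2 := @sqr_i R.
by apply: matrix2P; split; rewrite !(mxE, sum_I2) /= ?imaginaryE; field: i2.
Qed.

Lemma Kb_adj_unitary : Kb ^t* *m Kb = 1%:M :> 'M[R[i]]_2.
Proof. exact/mulmx1C/Kb_unitary. Qed.

(** $\breve K$ diagonalizes $\breve J$; this merges the two exponentials in $\Pi$ into the single
    equation $\Pi'=-A\Pi\breve J$. *)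
Lemma Kb_sigma3 : Kb *m sigma3 = 'i%C *: (Jb *m Kb) :> 'M[R[i]]_2.
Proof.
rewrite /Kb -scalemxAl -scalemxAr scalerA mulrC -scalerA; congr (_ *: _).
have i2 := @sqr_i R.
by apply: matrix2P; split; rewrite !(mxE, sum_I2) /= ?imaginaryE; ring: i2.
Qed.

Lemma sigma3_Kb_adj : 'i%C *: (sigma3 *m Kb ^t* ) = - (Kb ^t* *m Jb) :> 'M[R[i]]_2.
Proof.
rewrite -[LHS]mul1mx -Kb_adj_unitary -!mulmxA -mulmxN; congr (_ *m _).
rewrite -scalemxAr mulmxA Kb_sigma3 -scalemxAl scalerA -expr2 sqr_i.
by rewrite -mulmxA Kb_unitary mulmx1 scaleN1r.
Qed.

End PauliAlgebra.

(** * Differential equations and identity for $\Pi$ and $S$ *)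

Section DressingData.
Variables (R : realType) (n : nat).
Variables (A : 'M[R[i]]_n) (Pi0 : 'M[R[i]]_(n, 2)) (S0 : 'M[R[i]]_n).

Lemma ord2P (l : 'I_2) : l = 0 \/ l = 1.
Proof. by case: l => [[|[|//]] ?]; [left|right]; apply: val_inj. Qed.

Lemma row_mx_col0 (u w : 'cV[R[i]]_n) k : row_mx u w k (0 : 'I_2) = u k 0.
Proof. by rewrite (_ : (0 : 'I_2) = @lshift 1 1 0) ?row_mxEl //; apply: val_inj. Qed.

Lemma row_mx_col1 (u w : 'cV[R[i]]_n) k : row_mx u w k (1 : 'I_2) = w k 0.
Proof. by rewrite (_ : (1 : 'I_2) = @rshift 1 1 0) ?row_mxEr //; apply: val_inj. Qed.

Lemma row_mx_sigma3 (z : R[i]) (a b : 'cV[R[i]]_n) :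
  row_mx (z *: a) (- z *: b) = row_mx a b *m (z *: sigma3) :> 'M[R[i]]_(n, 2).
Proof.
apply/matrixP => k l; rewrite [RHS]mxE sum_I2 row_mx_col0 row_mx_col1.
by case: (ord2P l) => ->; rewrite ?row_mx_col0 ?row_mx_col1 !mxE /=; ring.
Qed.

Lemma is_derive_Pimx x :
  is_derive_mx (Pimx A Pi0) x (- (A *m Pimx A Pi0 x *m Jb)).
Proof.
have D1 := is_derive_mxMr (theta1 Pi0) (is_derive_expmx Num.imaginary A x).
have D2 := is_derive_mxMr (theta2 Pi0) (is_derive_expmx (- Num.imaginary) A x).
apply: is_derive_mx_ext (is_derive_mxMr (Kb ^t* ) (is_derive_mx_row D1 D2)) => //.
rewrite /Pimx; move: (expmx _) (expmx _) => E1 E2.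
rewrite -!scalemxAl (row_mx_sigma3 Num.imaginary) -mulmxA -scalemxAl imaginaryE.
rewrite sigma3_Kb_adj mulmxN; congr (- _).
by rewrite -!(mulmxA A) -mul_mx_row !mulmxA.
Qed.

Lemma Pimx0 : Pimx A Pi0 0 = Pi0.
Proof.
rewrite /Pimx !mulr0 !scale0r expmx0 !mul1mx.
rewrite (_ : row_mx (theta1 Pi0) (theta2 Pi0) = Pi0 *m Kb :> 'M[R[i]]_(n, 2)).
  by rewrite -mulmxA Kb_unitary mulmx1.
by apply/matrixP => k l; case: (ord2P l) => ->; rewrite ?row_mx_col0 ?row_mx_col1 [LHS]mxE.
Qed.

(** Unitarity of $\breve K$ makes it drop out, which exhibits the integrand of $S$ as $\Pi\Pi^*$. *)
Lemma gram_row (E1 E2 F1 F2 : 'M[R[i]]_n) (a b : 'cV[R[i]]_n) :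
  E1 ^t* = F1 -> E2 ^t* = F2 ->
  E1 *m a *m a ^t* *m F1 + E2 *m b *m b ^t* *m F2 =
  (row_mx (E1 *m a) (E2 *m b) *m Kb ^t* ) *m (row_mx (E1 *m a) (E2 *m b) *m Kb ^t* ) ^t*.
Proof.
move=> <- <-; rewrite adjmxM trmxCK mulmxA -(mulmxA _ (Kb ^t* )) Kb_adj_unitary mulmx1.
by rewrite adjmx_row mul_row_col !adjmxM !mulmxA.
Qed.

Lemma Pimx_gram (t : R) :
  expmx (('i * t%:C) *: A) *m theta1 Pi0 *m (theta1 Pi0) ^t*
    *m expmx ((- 'i * t%:C) *: A ^t* )
  + expmx ((- 'i * t%:C) *: A) *m theta2 Pi0 *m (theta2 Pi0) ^t*
    *m expmx (('i * t%:C) *: A ^t* ) = Pimx A Pi0 t *m (Pimx A Pi0 t) ^t*.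
Proof.
have conji : Num.conj (Num.imaginary * t%:C) = - Num.imaginary * t%:C.
  by rewrite rmorphM /= conjCi conjCE /= oppr0.
have conjNi : Num.conj (- Num.imaginary * t%:C) = Num.imaginary * t%:C.
  by rewrite mulNr rmorphN /= conji mulNr opprK.
have e1 : (expmx (('i * t%:C) *: A)) ^t* = expmx ((- 'i * t%:C) *: A ^t* ).
  by rewrite -expmx_adj adjmxZ conji.
have e2 : (expmx ((- 'i * t%:C) *: A)) ^t* = expmx (('i * t%:C) *: A ^t* ).
  by rewrite -expmx_adj adjmxZ conjNi; congr expmx.
exact: gram_row e1 e2.
Qed.

(** For negative $x$ the integral in [Smx] runs over an empty interval, so [Smx] is constant there
    and in general has no two-sided derivative at zero. An extension by primitives has one. *)
Lemma Smx_extension : exists S : R -> 'M[R[i]]_n,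
  [/\ forall x : R, 0 <= x -> Smx A Pi0 S0 x = S x, S 0 = S0 &
      forall x : R, 0 <= x -> is_derive_mx S x (Pimx A Pi0 x *m (Pimx A Pi0 x) ^t* )].
Proof.
pose F t := Pimx A Pi0 t *m (Pimx A Pi0 t) ^t*.
have DF x : is_derive_mx F x
    (- (A *m Pimx A Pi0 x *m Jb) *m (Pimx A Pi0 x) ^t* +
     Pimx A Pi0 x *m (- (A *m Pimx A Pi0 x *m Jb)) ^t* ).
  exact: is_derive_mxM (is_derive_Pimx x) (is_derive_mx_adj (is_derive_Pimx x)).
have /choice[f fP] : forall ij : 'I_n * 'I_n, exists h : R -> R, forall x : R, 0 <= x ->
    is_derive x 1 h (complex.Re (F x ij.1 ij.2)) /\
    \int[lebesgue_measure]_(s in `[0, x]) complex.Re (F s ij.1 ij.2) = h x - h 0.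
  move=> [i j] /=; apply: continuous_primitive => x.
  exact: (is_cderive_continuous (DF x i j)).1.
have /choice[g gP] : forall ij : 'I_n * 'I_n, exists h : R -> R, forall x : R, 0 <= x ->
    is_derive x 1 h (complex.Im (F x ij.1 ij.2)) /\
    \int[lebesgue_measure]_(s in `[0, x]) complex.Im (F s ij.1 ij.2) = h x - h 0.
  move=> [i j] /=; apply: continuous_primitive => x.
  exact: (is_cderive_continuous (DF x i j)).2.
pose S x := S0 + \matrix_(i, j) ((f (i, j) x - f (i, j) 0) +i* (g (i, j) x - g (i, j) 0)).
exists S; split.
- move=> x x0; rewrite /Smx /S; congr (_ + _).
  rewrite (_ : (fun t : R => _) = F); last by apply/funext => t; rewrite Pimx_gram.
  by apply/matrixP => i j; rewrite !mxE (fP (i, j) x x0).2 (gP (i, j) x x0).2.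
- apply/matrixP => i j; rewrite !mxE !subrr; exact: addr0.
- move=> x x0 i j.
  have [f1 _] := fP (i, j) x x0; have [g1 _] := gP (i, j) x x0.
  split.
    apply: is_derive_ext (is_deriveD f1
      (is_derive_cst (complex.Re (S0 i j) - f (i, j) 0) x 1)) => [t|].
      by rewrite !fctE !mxE raddfD /=; ring.
    by rewrite addr0.
  apply: is_derive_ext (is_deriveD g1
    (is_derive_cst (complex.Im (S0 i j) - g (i, j) 0) x 1)) => [t|].
    by rewrite !fctE !mxE raddfD /=; ring.
  by rewrite addr0.
Qed.

(** The defect of the algebraic identity has derivative zero: by $\breve J^2=-1$, the derivative of
    $\Pi\breve J\Pi^*$ is $A\Pi\Pi^*-\Pi\Pi^*A^*$. *)
Lemma dressing_data (S : R -> 'M[R[i]]_n) : S 0 = S0 ->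
  (forall x : R, 0 <= x -> is_derive_mx S x (Pimx A Pi0 x *m (Pimx A Pi0 x) ^t* )) ->
  A *m S0 - S0 *m A ^t* = Pi0 *m Jb *m Pi0 ^t* ->
  (forall x : R, 0 <= x -> (S x) ^t* = S x) ->
  forall x : R, 0 <= x -> dressing_at A (Pimx A Pi0) S 0 x.
Proof.
move=> S00 DS AS0 Sh x x0; split; [|exact: DS| |exact: Sh].
  by rewrite mulmx0 addr0; apply: is_derive_Pimx.
pose G t := A *m S t - S t *m A ^t* - Pimx A Pi0 t *m Jb *m (Pimx A Pi0 t) ^t*.
have G0 : G x = 0.
  rewrite (is_derive_mx0_cst (F := G) _ x0) => [|t t0].
    by rewrite /G S00 Pimx0 AS0 subrr.
  have DP := is_derive_Pimx t.
  have D := is_derive_mxD (is_derive_mxD (is_derive_mxMl A (DS t t0))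
      (is_derive_mxN (is_derive_mxMr (A ^t* ) (DS t t0))))
      (is_derive_mxN (is_derive_mxM (is_derive_mxMr Jb DP) (is_derive_mx_adj DP))).
    move: D; set D := (X in is_derive_mx _ _ X); suff -> : D = 0 by apply.
  rewrite /D; move: (Pimx A Pi0 t) => P {D DP}.
  have hJ : - (A *m P *m Jb) *m Jb = A *m P.
    by rewrite mulNmx -(mulmxA _ Jb Jb) JbJb mulmxN mulmx1 opprK.
  have hK : P *m Jb *m (- (A *m P *m Jb)) ^t* = - (P *m P ^t* *m A ^t* ).
    rewrite adjmxN !adjmxM Jb_adj mulNmx opprK !mulmxA -(mulmxA P Jb Jb) JbJb.
    by rewrite mulmxN mulmx1 !mulNmx.
  by rewrite hJ hK mulmxA subrr.
by apply/eqP; rewrite -subr_eq0 -[X in X == 0]/(G x) G0.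
Qed.

End DressingData.

(** * Transfer matrix *)

Section MainResults.
Variable R : realType.

Lemma dressing_potential_adj (X : 'M[R[i]]_2) : Jb *m X *m Jb ^t* - X = dressing_potential X.
Proof. by rewrite /dressing_potential Jb_adj mulmxN -opprD. Qed.

Lemma eigenvalue_unitmx n (A : 'M[R[i]]_n) lam : ~~ eigenvalue A lam -> A - lam%:M \in unitmx.
Proof. by rewrite /eigenvalue negbK /eigenspace kermx_eq0 row_free_unit. Qed.

(** The inverse is explicit, $1+\breve JP^*(A^*-\lambda)^{-1}S^{-1}P$; this is where
    $\lambda\notin\sigma(A^*\,)$ enters. Shifting both $A$ and $A^*$ by $\lambda$ preserves the
    identity, and the identity expresses the product of the two corrections as their difference. *)
Lemma transfer_unit n (A : 'M[R[i]]_n) (P : 'M[R[i]]_(n, 2)) (S : 'M[R[i]]_n) lam :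
  S \in unitmx -> A *m S - S *m A ^t* = P *m Jb *m P ^t* ->
  A - lam%:M \in unitmx -> A ^t* - lam%:M \in unitmx ->
  1%:M - Jb *m P ^t* *m invmx S *m invmx (A - lam%:M) *m P \in unitmx.
Proof.
move=> Su AS.
have : (A - lam%:M) *m S - S *m (A ^t* - lam%:M) = P *m Jb *m P ^t*.
  rewrite -AS mulmxBl mulmxBr mul_scalar_mx mul_mx_scalar.
  by rewrite opprB addrA subrK.
move: (A - lam%:M) (A ^t* - lam%:M) => B B' BS Bu B'u.
have KBi (Z : 'M[R[i]]_(n, 2)) : invmx B *m (B *m Z) = Z by rewrite mulKmx.
have KB' (Z : 'M[R[i]]_(n, 2)) : B' *m (invmx B' *m Z) = Z by rewrite mulKVmx.
have KS (Z : 'M[R[i]]_(n, 2)) : S *m (invmx S *m Z) = Z by rewrite mulKVmx.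
have KSi (Z : 'M[R[i]]_(n, 2)) : invmx S *m (S *m Z) = Z by rewrite mulKmx.
have KP (Z : 'M[R[i]]_(n, 2)) :
    P *m (Jb *m (P ^t* *m Z)) = B *m (S *m Z) - S *m (B' *m Z).
  by rewrite !mulmxA -BS mulmxBl.
move: (invmx S) (invmx B) (invmx B') KBi KB' KS KSi => Si Bi B'i KBi KB' KS KSi.
rewrite -!mulmxA; have := KP (B'i *m (Si *m P)); rewrite KB' KS => KN.
have MN : Jb *m (P ^t* *m (Si *m (Bi *m P))) *m (Jb *m (P ^t* *m (B'i *m (Si *m P)))) =
    Jb *m (P ^t* *m (B'i *m (Si *m P))) - Jb *m (P ^t* *m (Si *m (Bi *m P))).
  by rewrite -!mulmxA KN !mulmxBr KBi KSi.
apply: (@mulmx1_unit _ _ _ (1%:M + Jb *m (P ^t* *m (B'i *m (Si *m P)))) _).1.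
by rewrite mulmxDr mulmx1 mulmxBl mul1mx MN subKr subrK.
Qed.

(** The $2\times2$ remainder of the computation, with $X=P^*S^{-1}P$ and
    $Y=P^*S^{-1}(A-\lambda)^{-1}P$. *)
Lemma transfer_algebra2 (J X Y : 'M[R[i]]_2) lam : J *m J = - 1%:M ->
  - (J *m (J *m (X + lam *: Y - X *m (J *m Y))) - J *m (X *m Y) -
   J *m (X *m J + lam *: (Y *m J))) =
  lam *: (J *m (1%:M - J *m Y) - (1%:M - J *m Y) *m J) -
  - (J *m X *m J + X) *m (1%:M - J *m Y).
Proof.
move=> JJ; have JZ (Z : 'M[R[i]]_2) : J *m (J *m Z) = - Z by rewrite mulmxA JJ mulNmx mul1mx.
have -> : J *m (1%:M - J *m Y) = J + Y by rewrite mulmxBr mulmx1 JZ opprK.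
have -> : (1%:M - J *m Y) *m J = J - J *m (Y *m J) by rewrite mulmxBl mul1mx mulmxA.
have -> : - (J *m X *m J + X) *m (1%:M - J *m Y) =
    - (J *m (X *m J) + J *m (X *m Y) + X - X *m (J *m Y)).
  rewrite mulNmx mulmxBr mulmx1 mulmxDl -!mulmxA JZ !mulmxN.
  move: (J *m (X *m J)) (J *m (X *m Y)) (X *m (J *m Y)) => a b c.
  by apply/matrixP => k l; rewrite !mxE; ring.
rewrite JZ mulmxDr -scalemxAr.
move: (J *m (X *m J)) (J *m (X *m Y)) (J *m (Y *m J)) (X *m (J *m Y)) => a b c d.
by apply/matrixP => k l; rewrite !mxE; ring.
Qed.

(** [A'], [Q], [Si], [B] stand for $A^*$, $P^*$, $S^{-1}$, $(A-\lambda)^{-1}$. The relations carry a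
    right factor [Z] so that they rewrite inside right-nested products. *)
Lemma transfer_algebra n (A A' B Si : 'M[R[i]]_n) (P : 'M[R[i]]_(n, 2)) (Q : 'M[R[i]]_(2, n))
    (J : 'M[R[i]]_2) lam :
  J *m J = - 1%:M ->
  (forall Z : 'M[R[i]]_(n, 2), A' *m (Si *m Z) =
     Si *m (A *m Z) - Si *m (P *m (J *m (Q *m (Si *m Z))))) ->
  (forall Z : 'M[R[i]]_(n, 2), A *m (B *m Z) = Z + lam *: (B *m Z)) ->
  (forall Z : 'M[R[i]]_(n, 2), B *m (A *m Z) = Z + lam *: (B *m Z)) ->
  - ((J *m (J *m (Q *m A')) *m Si + J *m Q *m - (Si *m (P *m Q) *m Si)) *m B *m P +
     J *m Q *m Si *m B *m - (A *m P *m J)) =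
  lam *: (J *m (1%:M - J *m Q *m Si *m B *m P) - (1%:M - J *m Q *m Si *m B *m P) *m J) -
  - (J *m (Q *m Si *m P) *m J + Q *m Si *m P) *m (1%:M - J *m Q *m Si *m B *m P).
Proof.
move=> JJ KA' KAB KBA.
have Y1 : J *m Q *m Si *m B *m P = J *m (Q *m (Si *m (B *m P))) by rewrite !mulmxA.
have hA : Q *m (A' *m (Si *m (B *m P))) = Q *m Si *m P + lam *: (Q *m (Si *m (B *m P)))
    - (Q *m Si *m P) *m (J *m (Q *m (Si *m (B *m P)))).
  by rewrite KA' mulmxBr KAB !mulmxDr -!scalemxAr -!mulmxA.
have hB : Q *m (Si *m (B *m (A *m (P *m J)))) =
    (Q *m Si *m P) *m J + lam *: ((Q *m (Si *m (B *m P))) *m J).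
  by rewrite KBA !mulmxDr -!scalemxAr -!mulmxA.
have E1 : J *m (J *m (Q *m A')) *m Si *m B *m P = J *m (J *m (Q *m (A' *m (Si *m (B *m P))))).
  by rewrite !mulmxA.
have E2 : J *m Q *m (Si *m (P *m Q) *m Si) *m B *m P =
    J *m ((Q *m Si *m P) *m (Q *m (Si *m (B *m P)))).
  by rewrite !mulmxA.
have E3 : J *m Q *m Si *m B *m (A *m P *m J) = J *m (Q *m (Si *m (B *m (A *m (P *m J))))).
  by rewrite !mulmxA.
rewrite mulmxDl mulmxDl mulmxN mulmxN mulNmx mulNmx E1 E2 E3 hA hB Y1.
exact: transfer_algebra2.
Qed.

(** The extra term $-\lambda w\breve J$ is the one that the factor $\breve Ke^{-i\lambda x\sigma_3}$
    of the solution cancels. *)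
Lemma is_derive_transfer n (A : 'M[R[i]]_n) (P : R -> 'M[R[i]]_(n, 2)) (S : R -> 'M[R[i]]_n) lam x :
  dressing_at A P S 0 x -> S x \in unitmx -> A - lam%:M \in unitmx ->
  let w t := 1%:M - Jb *m (P t) ^t* *m invmx (S t) *m invmx (A - lam%:M) *m P t in
  is_derive_mx w x (lam *: (Jb *m w x - w x *m Jb)
    - dressing_potential ((P x) ^t* *m invmx (S x) *m P x) *m w x).
Proof.
move=> [DP DS AS Sh] Su Bu w.
have := is_derive_mxD (is_derive_mx_cst 1%:M x) (is_derive_mxN (is_derive_mxM
  (is_derive_mxMr (invmx (A - lam%:M)) (is_derive_mxM (is_derive_mxMl Jb (is_derive_mx_adj DP))
    (is_derive_mxV DS Su))) DP)).
rewrite -/w; congr is_derive_mx; rewrite !mulmx0 !addr0 add0r /w /dressing_potential.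
have KSi (Z : 'M[R[i]]_(n, 2)) : S x *m (invmx (S x) *m Z) = Z by rewrite mulKVmx.
have KS (Z : 'M[R[i]]_(n, 2)) : invmx (S x) *m (S x *m Z) = Z by rewrite mulKmx.
have KAB (Z : 'M[R[i]]_(n, 2)) : A *m (invmx (A - lam%:M) *m Z) =
    Z + lam *: (invmx (A - lam%:M) *m Z).
  rewrite -{2}(mulKVmx Bu Z); set W := _ *m Z.
  by rewrite mulmxBl mul_scalar_mx subrK.
have KBA (Z : 'M[R[i]]_(n, 2)) : invmx (A - lam%:M) *m (A *m Z) =
    Z + lam *: (invmx (A - lam%:M) *m Z).
  have E : A *m Z = (A - lam%:M) *m Z + lam *: Z by rewrite mulmxBl mul_scalar_mx subrK.
  by rewrite E mulmxDr mulKmx // -scalemxAr.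
move: (P x) (S x) (invmx (A - lam%:M)) (invmx (S x)) AS KSi KS KAB KBA =>
  P' S' B Si AS KSi KS KAB KBA {w}.
have KA' (Z : 'M[R[i]]_(n, 2)) : A ^t* *m (Si *m Z) =
    Si *m (A *m Z) - Si *m (P' *m (Jb *m (P' ^t* *m (Si *m Z)))).
  rewrite -[LHS]KS -mulmxBr; congr (_ *m _).
  by rewrite !mulmxA -AS !mulmxBl -!mulmxA KSi opprB addrC subrK.
rewrite adjmxN !adjmxM Jb_adj [- Jb *m _]mulNmx opprK.
exact: transfer_algebra (JbJb R) KA' KAB KBA.
Qed.

End MainResults.

(** * Pole of the potential at zero *)

Section Assembly.
Variable R : realType.

(** $R$ is chosen so that $R\mathcal S_1$ is the lower left block of the right-hand side; the two
    assumed identities give the diagonal blocks. *)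
Lemma dressing_identity0 m k (A1 S1 : 'M[R[i]]_m) (A2 : 'M[R[i]]_k)
    (Psi1 : 'M[R[i]]_(m, 2)) (Psi2 : 'M[R[i]]_(k, 2)) :
  posdefmx S1 ->
  A1 *m S1 - S1 *m A1 ^t* = Psi1 *m Jb *m Psi1 ^t* ->
  Psi2 *m Jb *m Psi2 ^t* = 0 ->
  let A := Amx A1 S1 A2 Psi1 Psi2 in let S0 := block_mx S1 0 0 0 in
  let Pi0 := col_mx Psi1 Psi2 in
  A *m S0 - S0 *m A ^t* = Pi0 *m Jb *m Pi0 ^t*.
Proof.
move=> S1p hid1 hid2 A S0 Pi0; have S1u := posdefmx_unit S1p; have S1h := posdefmx_adj S1p.
have RS : (Psi2 *m Jb *m Psi1 ^t* *m invmx S1) *m S1 = Psi2 *m Jb *m Psi1 ^t* by rewrite mulmxKV.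
have SR : S1 *m (Psi2 *m Jb *m Psi1 ^t* *m invmx S1) ^t* = - (Psi1 *m Jb *m Psi2 ^t* ).
  have := congr1 (fun M => M ^t* ) RS; rewrite adjmxM S1h => ->.
  by rewrite !adjmxM trmxCK Jb_adj mulNmx mulmxN mulmxA.
rewrite /A /Amx /S0 /Pi0 adjmx_block adjmx0 !mulmx_block RS SR.
rewrite !(mulmx0, mul0mx, addr0) opp_block_mx add_block_mx hid1 !oppr0 !addr0 add0r opprK.
by rewrite mul_col_mx adjmx_col mul_col_row hid2.
Qed.

Lemma posdefmx_block0 m k (S1 : 'M[R[i]]_m) : posdefmx S1 ->
  (block_mx S1 0 0 0 : 'M[R[i]]_(m + k)) ^t* = block_mx S1 0 0 0.
Proof. by move=> /posdefmx_adj S1h; rewrite adjmx_block !adjmx0 S1h. Qed.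

Lemma simple_pole_regular (Y : R -> 'M[R[i]]_2) D :
  is_derive_mx Y 0 D -> simple_pole 0 Y.
Proof.
move=> YD; split.
  apply: (bounded_near_zero_eq ltr01 _ (is_cderive_bounded
    (is_cderiveD (YD 1 1) (is_cderiveN (YD 0 0))))) => x _ _.
  by rewrite mul0r subr0.
exact: is_cderive_bounded (is_cderiveD (YD 0 1) (YD 1 0)).
Qed.

(** The $m\times m$ block stays invertible down to $x=0$, so its form is differentiable there and
    has residue $0$. The elimination of rows then starts with $n=0$ and with [s] read off from the
    first row of $\Psi_2(0)$. *)
Lemma Xmx_simple_pole m k (s : bool) (A1 S1 : 'M[R[i]]_m) (A2 : 'M[R[i]]_k)
    (Psi1 : 'M[R[i]]_(m, 2)) (Psi2 : 'M[R[i]]_(k, 2)) :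
  posdefmx S1 -> is_trig_mx A2 ->
  A1 *m S1 - S1 *m A1 ^t* = Psi1 *m Jb *m Psi1 ^t* ->
  Psi2 *m Jb *m Psi2 ^t* = 0 ->
  (forall i : 'I_k, val i = 0%N -> exists2 c : R[i], c != 0 &
     row i Psi2 = c *: delta_mx 0 (if s then 1 else 0)) ->
  let A := Amx A1 S1 A2 Psi1 Psi2 in let S0 := block_mx S1 0 0 0 in
  let Pi0 := col_mx Psi1 Psi2 in
  (forall x : R, 0 < x -> posdefmx (Smx A Pi0 S0 x)) ->
  simple_pole ((-1) ^+ (s (+) odd k) * k%:R) (Xmx A Pi0 S0).
Proof.
move=> S1p trigA2 hid1 hid2 row0 A S0 Pi0 Sp.
have [S [SE S00 DS]] := Smx_extension A Pi0 S0.
have Sp' x : 0 < x -> posdefmx (S x) by move=> x0; rewrite -SE ?ltW //; apply: Sp.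
have Sh x : 0 <= x -> (S x) ^t* = S x.
  rewrite le_eqVlt => /predU1P[<-|x0]; last exact: posdefmx_adj (Sp' x x0).
  by rewrite S00 posdefmx_block0.
have dress := dressing_data S00 DS (dressing_identity0 A2 S1p hid1 hid2) Sh.
pose P := Pimx A Pi0.
have Tu x : 0 <= x -> ulsubmx (S x) \in unitmx.
  rewrite le_eqVlt => /predU1P[<-|x0].
    by rewrite S00 block_mxKul posdefmx_unit.
  exact: posdefmx_unit (schurT_posdef (Sp' x x0)).1.
have schur x (x0 : 0 <= x) := schur_dressing (Sh x x0) (Tu x x0) (dress x x0).
have [DP1 DT1] := leading_dressing (dress 0 (lexx 0)).
have D1 := is_derive_mxM (is_derive_mxM (is_derive_mx_adj DP1)
  (is_derive_mxV DT1 (Tu 0 (lexx 0)))) DP1.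
(* The lower blocks of $S(0)$ are zero: the Schur complement leaves $\Psi_2(0)$ unchanged, and the
   remaining positive matrix starts from $0$. *)
have P0 : schurP P S 0 = Psi2.
  by rewrite schurPE /P Pimx0 S00 block_mxKdl mul0mx mul0mx subr0 col_mxKd.
have T0 : schurT S 0 = 0.
  by rewrite schurTE ?Sh ?Tu // S00 block_mxKdl block_mxKdr !mul0mx subr0.
have [DP2 DT2 _ _] := schur 0 (lexx 0).
apply: (@simple_pole_ext R _ (fun x => leading_form P S x +
   (schurP P S x) ^t* *m invmx (schurT S x) *m schurP P S x)).
  move=> x x0; have T2 := posdefmx_unit (schurT_posdef (Sp' x x0)).2.
  apply: etrans (esym (quadratic_form_schur P (Sh x (ltW x0)) (Tu x (ltW x0)) T2)) _.
  by rewrite /Xmx SE // ltW.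
rewrite -[k in k%:R]add0n; apply: (@dressing_poles R k 0 s A2).
- exact: trigA2.
- by move=> x x0; have := schur x (ltW x0); rewrite add0r.
- by move=> x x0; apply: (schurT_posdef (Sp' x x0)).2.
- by move=> i; apply: is_cderive_vanishes (DT2 i i) _; rewrite T0 mxE.
- by rewrite mulr0; apply: simple_pole_regular D1.
- move=> i i0; right; have [c c0 rowi] := row0 i i0.
  apply: (@regular_minor_small R s _ (row i _) c _ c0); last by rewrite P0.
  move=> a b; rewrite mxE; apply: is_cderive_ext (DP2 i b) => x.
  by rewrite [RHS]mxE.
Qed.

(** The parity condition on $h(0)$ is designed for this: flipped $|\kappa|$ times, it becomes the
    sign bit of $\kappa$. *)
Lemma signed_absz (k : int) : k != 0 ->
  (-1) ^+ ((((0 < k) && odd `|k|%N) || ((k < 0) && ~~ odd `|k|%N)) (+) odd `|k|%N) * `|k|%N%:R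
  = k%:~R :> R[i].
Proof.
case: k => [[|n]|n] // _.
  by rewrite /= orbF addbb expr0 mul1r.
by rewrite NegzE /= mulrNz; case: odd; rewrite /= expr1 mulN1r.
Qed.

(* [w] stands for the transfer matrix and [E] for [exp (- i lam x sigma3)]. *)
Lemma system_algebra (w E q : 'M[R[i]]_2) lam :
  (lam *: (Jb *m w - w *m Jb) - q *m w) *m Kb *m E +
    (w *m Kb) *m ((- Num.imaginary * lam) *: (sigma3 *m E))
  - lam *: (Jb *m (w *m Kb *m E)) + q *m (w *m Kb *m E) = 0.
Proof.
rewrite imaginaryE; move: (@Kb R) (@Jb R) (@sigma3 R) (@Kb_sigma3 R) => K J s3 Ks3.
rewrite -scalemxAr (mulmxA (w *m K)) -(mulmxA w K) Ks3 -scalemxAr -scalemxAl.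
rewrite scalerA mulrC mulrA mulrN -expr2 sqr_i opprK mul1r.
rewrite mulmxBl mulmxBl -!scalemxAl mulmxBl mulmxBl scalerBr -!mulmxA.
move: (J *m (w *m _)) (w *m (J *m _)) (q *m _) => a b c.
by apply/matrixP => k l; rewrite !mxE; ring.
Qed.

End Assembly.

Theorem theorem4p1 (R : realType) (kappa : int) (hkappa : kappa != 0)
  (m : nat) (hm : (0 < m)%N)
  (A1 S1 : 'M[R[i]]_m) (A2 : 'M[R[i]]_`|kappa|%N)
  (Psi1 : 'M[R[i]]_(m, 2)) (Psi2 : 'M[R[i]]_(`|kappa|%N, 2))
  (hS1 : posdefmx S1) (hA2 : is_trig_mx A2)
  (hid1 : A1 *m S1 - S1 *m A1 ^t* = Psi1 *m Jb *m Psi1 ^t*)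
  (hid2 : Psi2 *m Jb *m Psi2 ^t* = 0)
  (hrow : exists2 c : R[i], c != 0 &
     (((0 < kappa) && odd `|kappa|%N || (kappa < 0) && ~~ odd `|kappa|%N) ->
        row (ord_first hkappa) Psi2 = c *: delta_mx 0 1) /\
     (((0 < kappa) && ~~ odd `|kappa|%N || (kappa < 0) && odd `|kappa|%N) ->
        row (ord_first hkappa) Psi2 = c *: delta_mx 0 0)) :
  let A := Amx A1 S1 A2 Psi1 Psi2 in
  let Pi0 := col_mx Psi1 Psi2 in
  let S0 := block_mx S1 0 0 0 in
  let X := Xmx A Pi0 S0 in
  let q0 := potential A Pi0 S0 in
  (forall x : R, 0 < x -> posdefmx (Smx A Pi0 S0 x)) ->
  (exists (Upsilon : R -> 'M[R[i]]_2) (va vs : R -> R[i]),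
     [/\ forall x : R, 0 < x ->
           q0 x = (kappa%:~R / x%:C) *: sigma3 + Upsilon x /\
           (kappa%:~R / x%:C) *: sigma3 + Upsilon x =
             (kappa%:~R / x%:C) *: sigma3 + va x *: sigma3 - vs x *: sigma1,
         forall x : R, 0 < x ->
           va x = X x 1 1 - X x 0 0 - kappa%:~R / x%:C /\
           vs x = X x 0 1 + X x 1 0,
         bounded_near_zero Upsilon,
         bounded_near_zero va &
         bounded_near_zero vs]) /\
  (forall lam : R[i], ~~ eigenvalue A lam -> ~~ eigenvalue (A ^t*) lam ->
     fundamental_solution q0 lam
       (fun x => transfer A Pi0 S0 x lam *m Kb
                   *m expmx ((- 'i * lam * x%:C) *: sigma3))).
Proof.
move=> A Pi0 S0 X q0 Sp; split.
  (* [s] holds exactly when $h(0)$ is prescribed along $[0\;\;1]$. *)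
  pose s := (0 < kappa) && odd `|kappa|%N || (kappa < 0) && ~~ odd `|kappa|%N.
  have sC : ~~ s -> (0 < kappa) && ~~ odd `|kappa|%N || (kappa < 0) && odd `|kappa|%N.
    rewrite /s; have := hkappa; rewrite neq_lt => /orP[]k0; rewrite k0 (lt_gtF k0) /=.
      by rewrite negbK.
    by rewrite !orbF.
  have row0 (i : 'I_`|kappa|) : val i = 0%N -> exists2 c : R[i], c != 0 &
      row i Psi2 = c *: delta_mx 0 (if s then 1 else 0).
    move=> i0; have -> : i = ord_first hkappa by apply: val_inj.
    case: hrow => c c0 [h1 h0]; exists c => //.
    by case: ifPn => [/h1|/sC/h0].
  have kE := signed_absz R hkappa.
  have [bva bvs] := Xmx_simple_pole hS1 hA2 hid1 hid2 row0 Sp.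
  rewrite -/s in kE; rewrite kE in bva.
  pose va x := X x 1 1 - X x 0 0 - kappa%:~R / x%:C.
  pose vs x := X x 0 1 + X x 1 0.
  have bZ (f : R -> R[i]) (M : 'M[R[i]]_2) : bounded_near_zero f ->
      bounded_near_zero (fun x => f x *: M).
    move=> [e [B [e0 fB]]]; exists e, (B * complex.Re `|M|); split=> // x x0 xe.
    have -> : `|f x *: M| = `|f x| * `|M| by rewrite normrZ.
    by rewrite rmorphM /= RRe_real ?ger0_real // ler_wpM2r // fB.
  exists (fun x => va x *: sigma3 - vs x *: sigma1), va, vs; split=> //.
  - move=> x x0; split; last by rewrite addrA.
    rewrite /q0 /potential dressing_potential_adj dressing_potentialE /va /vs /X.
    by move: (Xmx _ _ _ _) => M; apply: matrix2P; split; rewrite !mxE /=; ring.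
  - exact: (bounded_near_zeroD (bZ _ sigma3 bva) (bounded_near_zeroN (bZ _ sigma1 bvs))).
move=> lam /eigenvalue_unitmx Bu /eigenvalue_unitmx B'u x x0.
have [S [SE S00 DS]] := Smx_extension A Pi0 S0.
have Sp' y : 0 < y -> posdefmx (S y) by move=> y0; rewrite -SE ?ltW //; apply: Sp.
have Sh y : 0 <= y -> (S y) ^t* = S y.
  rewrite le_eqVlt => /predU1P[<-|y0]; last exact: posdefmx_adj (Sp' y y0).
  by rewrite S00 posdefmx_block0.
have dress := dressing_data S00 DS (dressing_identity0 A2 hS1 hid1 hid2) Sh (ltW x0).
have Su := posdefmx_unit (Sp' x x0).
have [_ _ AS _] := dress.
have wu : transfer A Pi0 S0 x lam \in unitmx.
  by rewrite /transfer SE ?ltW //; apply: transfer_unit.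
have Ku : (Kb : 'M[R[i]]_2) \in unitmx by have [] := mulmx1_unit (Kb_unitary R).
split.
  by rewrite !unitmx_mul wu Ku expmx_unit // ltW.
have Dw : is_derive_mx (fun t => transfer A Pi0 S0 t lam) x
    (lam *: (Jb *m transfer A Pi0 S0 x lam - transfer A Pi0 S0 x lam *m Jb)
      - q0 x *m transfer A Pi0 S0 x lam).
  (* At $x>0$ the derivative depends only on nearby positive points, where [Smx] agrees with its
     extension. *)
  have wE t : 0 < t -> transfer A Pi0 S0 t lam =
      1%:M - Jb *m (Pimx A Pi0 t) ^t* *m invmx (S t) *m invmx (A - lam%:M) *m Pimx A Pi0 t.
    by move=> t0; rewrite /transfer SE // ltW.
  have qE : q0 x = dressing_potential ((Pimx A Pi0 x) ^t* *m invmx (S x) *m Pimx A Pi0 x).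
    by rewrite /q0 /potential dressing_potential_adj /Xmx SE // ltW.
  rewrite wE // qE; apply: near_is_derive_mx (is_derive_transfer dress Su Bu).
  by near=> t; rewrite wE //; near: t; exact: lt_nbhsr.
have De := is_derive_expmx (- Num.imaginary * lam) (sigma3 : 'M[R[i]]_2) x.
eexists; first exact: is_derive_mxM (is_derive_mxMr Kb Dw) De.
exact: system_algebra.
Unshelve. all: by end_near.
Qed.
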